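(* Let $(S,\Sigma_S,\nu)$ and $(T,\Sigma_T,\eta)$ be standard measure spaces, let $b\colon T\to[0,\nu(S)]$ and $c\colon S\to[0,\eta(T)]$ be Borel measurable, and let $E\subseteq S\times T$ be measurable with respect to $\Sigma_S\otimes\Sigma_T$. There exists a measurable set $F\subseteq E$ such that $\nu(F_t)=b(t)$ for $\eta$-almost every $t\in T$ and $\eta(F^s)=c(s)$ for $\nu$-almost every $s\in S$ if and only if $$\int_Tb(t)\,d\eta(t)=\int_Sc(s)\,d\nu(s)$$ and, for every measurable $A\subseteq T$, $$\int_Ab(t)\,d\eta(t)\le\int_S\min\{c(s),d_E(A,s)\}\,d\nu(s),$$ where $d_E(A,s)=\eta(E^s\cap A)$.
   Context: A standard measure space is a standard Borel space equipped with a finite atomless measure. For $X\subseteq S\times T$, the sections are $X_t=\{s\in S\mid(s,t)\in X\}$ for $t\in T$ and $X^s=\{t\in T\mid(s,t)\in X\}$ for $s\in S$. *)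

(* Defs.v *)
From HB Require Import structures.
From mathcomp Require Import all_boot all_order all_algebra.
From mathcomp Require Import all_classical all_reals all_analysis.

Set Implicit Arguments.
Unset Strict Implicit.
Unset Printing Implicit Defensive.

Import Order.TTheory GRing.Theory Num.Theory.
Import numFieldNormedType.Exports.

Local Open Scope classical_set_scope.
Local Open Scope ring_scope.

(* [cauchy] and [-->] are about the uniformity of [X], which is the one induced
   by its distance [mdist].  Completeness is stated as in [completeType], but as
   a predicate: the library has no join of [completeType] and [metricType]. *)
Definition complete_metric (R : realType) (X : metricType R) : Prop :=
  forall F : set_system X, ProperFilter F -> cauchy F -> exists x : X, F --> x.

Definition separable_space (X : topologicalType) : Prop :=
  exists2 D : set X, countable D & dense D.

(* [T] is isomorphic, as a measurable space, to a complete separable metric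
   space [X] with its Borel sigma-algebra [<<s open >>]. *)
Definition standard_borel (R : realType) (d : measure_display)
    (T : measurableType d) : Prop :=
  exists X : metricType R,
    [/\ complete_metric X, separable_space X &
      exists f : T -> X, bijective f /\
        forall B : set X, measurable (f @^-1` B) <-> <<s open >> B].

Definition atom (R : realType) (d : measure_display) (T : measurableType d)
    (mu : {measure set T -> \bar R}) (A : set T) : Prop :=
  [/\ measurable A, (0 < mu A)%E &
    forall B : set T, measurable B -> B `<=` A -> mu B = 0%E \/ mu B = mu A].

Definition atomless (R : realType) (d : measure_display) (T : measurableType d)
    (mu : {measure set T -> \bar R}) : Prop :=
  forall A : set T, ~ atom mu A.

Definition standard_measure_space (R : realType) (d : measure_display)
    (T : measurableType d) (mu : {finite_measure set T -> \bar R}) : Prop :=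
  standard_borel R T /\ atomless mu.

(* [d_E(A, s)]; [xsection E s] is the section [E^s] and [ysection E t] is the
   section [E_t]. *)
Definition degree (R : realType) (dS dT : measure_display)
    (S : measurableType dS) (T : measurableType dT)
    (eta : {finite_measure set T -> \bar R}) (E : set (S * T))
    (A : set T) (s : S) : \bar R :=
  eta (xsection E s `&` A).

(* Main.v *)
Require Import Defs.
From HB Require Import structures.
From mathcomp Require Import all_boot all_order all_algebra.
From mathcomp Require Import all_classical all_reals all_analysis.
From mathcomp Require Import measurable_realfun ring lra.

Set Implicit Arguments.
Unset Strict Implicit.
Unset Printing Implicit Defensive.

Import Order.TTheory GRing.Theory Num.Theory.
Import numFieldNormedType.Exports.

Local Open Scope classical_set_scope.
Local Open Scope ring_scope.

(** Necessity is Fubini's theorem: the measure of [F] inside [S * A] is the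
    integral of [b] over [A], and each section of this part of [F] has measure
    at most [c s] and at most the degree of [s] in [A].

    For sufficiency, first relax [F] to a measurable function [f] with [0 <= f
    <= 1_E] and the prescribed marginals [c] and [b]. Choose [f] to minimize the
    sum of the squared L2 distances of its marginals from [c] and [b]. At a
    minimum the first order condition shows that [f] saturates the rectangle on
    which both marginals fall short, and applying the cut condition to the set
    [A] of the columns that fall short leaves no defect at all
    ([fractional_solution]).

    To round [f], choose functions [x] on [S] and [y] on [T] with null fibres
    and maximize the integral of [x s * y t * f (s, t)] among the functions with
    these marginals. If [p = f * (1_E - f)] did not vanish almost everywhere,
    there would be rectangles with all four corners in the support of [p], and
    moving mass around their corners, upward or downward according to the sign
    of [(x s' - x s) * (y t' - y t)], would keep the marginals and increase the
    integral. Averaging over all rectangles with weight [p] makes this an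
    explicit perturbation, whose gain is half the integral of the squares [(y t
    - y t') ^+ 2] times Cauchy-Schwarz gaps ([perturbation_gain]); the gain
    vanishes only if [p] does, because the fibres of [x] and [y] are null
    ([perturbation_gain_le0]). So a maximizer takes almost everywhere only the
    values 0 and [1_E], and is the indicator function of the wanted set
    ([extremal_solution]).

    Both extremal functions exist by the same principle ([attained_minimum]): in
    a convex set of uniformly bounded functions that is closed under almost
    everywhere limits, near-optimizers of nearly minimal L2 norm converge. The
    functions with null fibres come from a countable family of measurable sets
    that separates the points of a standard Borel space; a fibre of positive
    measure would be an atom ([standard_diffuse]). *)

(** * Bounded measurable functions and their integrals *)

(** Bounded measurable functions form an algebra that is closed under taking
    sections and partial integrals, and over a finite measure their integrals
    are real numbers that add up without side conditions. Staying in this class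
    avoids tracking integrability. *)
Definition bmf (R : realType) (d : measure_display) (X : measurableType d)
    (f : X -> R) : Prop :=
  measurable_fun setT f /\ exists M : R, forall x, `|f x| <= M.

Section BoundedMeasurable.
Context (R : realType) (d : measure_display) (X : measurableType d).
Implicit Types f g : X -> R.

Lemma bmf_cst (r : R) : bmf (fun _ : X => r).
Proof. by split; [exact: measurable_cst | exists `|r|]. Qed.

Lemma bmfD f g : bmf f -> bmf g -> bmf (fun x => f x + g x).
Proof.
move=> [mf [M fM]] [mg [N gN]]; split; first exact: measurable_funD.
by exists (M + N) => x; rewrite (le_trans (ler_normD _ _))// lerD.
Qed.

Lemma bmfN f : bmf f -> bmf (fun x => - f x).
Proof.
move=> [mf [M fM]]; split; first exact: measurable_funN.
by exists M => x; rewrite normrN.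
Qed.

Lemma bmfM f g : bmf f -> bmf g -> bmf (fun x => f x * g x).
Proof.
move=> [mf [M fM]] [mg [N gN]]; split; first exact: measurable_funM.
by exists (M * N) => x; rewrite normrM ler_pM.
Qed.

Lemma bmfX f n : bmf f -> bmf (fun x => f x ^+ n).
Proof.
move=> bf; elim: n => [|n IH]; first exact: bmf_cst.
by under eq_fun do rewrite exprS; exact: bmfM.
Qed.

Lemma bmf_of_bounds f (m : \bar R) : m \is a fin_num ->
  measurable_fun setT f -> (forall x, (0 <= (f x)%:E <= m)%E) -> bmf f.
Proof.
move=> m_fin mf fm; split => //; exists (fine m) => x.
by have /andP[f0 fmx] := fm x; rewrite ger0_norm// -lee_fin fineK.
Qed.

Lemma bmf_indic (A : set X) : measurable A -> bmf (\1_A : X -> R).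
Proof.
move=> mA; split; first exact: measurable_indic.
by exists 1 => x; rewrite indicE; case: (x \in A); rewrite ?normr1 ?normr0.
Qed.

Lemma bmf_ge0_le f g : measurable_fun setT f -> bmf g ->
  (forall x, 0 <= f x <= g x) -> bmf f.
Proof.
move=> mf [_ [M gM]] fg; split => //; exists M => x.
have /andP[f0 fgx] := fg x.
by rewrite ger0_norm// (le_trans fgx)// (le_trans (ler_norm _)).
Qed.

Lemma bmf_min f g : bmf f -> bmf g -> bmf (fun x => Num.min (f x) (g x)).
Proof.
move=> [mf [M fM]] [mg [N gN]]; split; first exact: measurable_minr.
exists (Num.max M N) => x.
by case: (leP (f x) (g x)) => _; rewrite le_max ?fM ?gN ?orbT.
Qed.

Lemma bmf_comp (d' : measure_display) (Y : measurableType d') (h : Y -> X) f :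
  measurable_fun setT h -> bmf f -> bmf (fun y => f (h y)).
Proof.
move=> mh [mf [M fM]]; split; first exact: measurableT_comp mf mh.
by exists M => y.
Qed.

End BoundedMeasurable.

Section BoundedMeasurableProduct.
Context (R : realType) (dX dY : measure_display).
Context (X : measurableType dX) (Y : measurableType dY).

Lemma bmf_fst (f : X -> R) : bmf f -> bmf (fun p : X * Y => f p.1).
Proof. by apply: bmf_comp; exact: measurable_fst. Qed.

Lemma bmf_snd (f : Y -> R) : bmf f -> bmf (fun p : X * Y => f p.2).
Proof. by apply: bmf_comp; exact: measurable_snd. Qed.

Lemma bmf_pair1 (f : X * Y -> R) x : bmf f -> bmf (fun y => f (x, y)).
Proof. by apply: bmf_comp; exact: pair1_measurable. Qed.

Lemma bmf_pair2 (f : X * Y -> R) y : bmf f -> bmf (fun x => f (x, y)).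
Proof. by apply: bmf_comp; exact: pair2_measurable. Qed.

End BoundedMeasurableProduct.

Ltac solve_bmf := solve [repeat first
  [ exact: bmf_cst | solve [auto] | apply: bmfN | apply: bmfX | apply: bmfM
  | apply: bmfD | apply: bmf_fst | apply: bmf_snd
  | apply: bmf_pair1 | apply: bmf_pair2 ]].

Section BoundedIntegral.
Context (R : realType) (d : measure_display) (X : measurableType d).
Variable mu : {finite_measure set X -> \bar R}.
Implicit Types f g : X -> R.

Lemma finite_measure_lty : (mu setT < +oo)%E.
Proof. by rewrite ltey_eq fin_num_measure. Qed.

Lemma bmf_integrable f : bmf f -> mu.-integrable setT (EFin \o f).
Proof.
move=> [mf [M fM]]; apply: measurable_bounded_integrable => //.
  exact: finite_measure_lty.
exists M; split; first exact: num_real.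
by move=> N MN x _ /=; rewrite (le_trans (fM x))// ltW.
Qed.

Lemma EFin_Rintegral f : bmf f -> (\int[mu]_x f x)%:E = (\int[mu]_x (f x)%:E)%E.
Proof.
move=> /bmf_integrable f_int; rewrite /Rintegral fineK//.
exact: integrable_fin_num f_int.
Qed.

Lemma bmf_intD f g : bmf f -> bmf g ->
  \int[mu]_x (f x + g x) = \int[mu]_x f x + \int[mu]_x g x.
Proof. by move=> bf bg; rewrite RintegralD//; exact: bmf_integrable. Qed.

Lemma bmf_intB f g : bmf f -> bmf g ->
  \int[mu]_x (f x - g x) = \int[mu]_x f x - \int[mu]_x g x.
Proof. by move=> bf bg; rewrite RintegralB//; exact: bmf_integrable. Qed.

Lemma bmf_intZ r f : bmf f -> \int[mu]_x (r * f x) = r * \int[mu]_x f x.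
Proof. by move=> bf; rewrite RintegralZl//; exact: bmf_integrable. Qed.

Lemma bmf_intN f : bmf f -> \int[mu]_x (- f x) = - \int[mu]_x f x.
Proof.
move=> bf; rewrite -mulN1r -bmf_intZ//.
by apply: eq_Rintegral => x _; rewrite mulN1r.
Qed.

Lemma bmf_le_int f g : bmf f -> bmf g -> (forall x, f x <= g x) ->
  \int[mu]_x f x <= \int[mu]_x g x.
Proof.
by move=> bf bg fg; apply: le_Rintegral => //; exact: bmf_integrable.
Qed.

Lemma int_ge0 f : (forall x, 0 <= f x) -> 0 <= \int[mu]_x f x.
Proof. by move=> f0; apply: Rintegral_ge0. Qed.

Lemma int_indic (A : set X) : measurable A ->
  \int[mu]_x (\1_A x : R) = fine (mu A).
Proof. by move=> mA; rewrite /Rintegral integral_indic// setIT. Qed.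

Lemma ae_eq_int f g : bmf f -> bmf g -> {ae mu, forall x, f x = g x} ->
  \int[mu]_x f x = \int[mu]_x g x.
Proof.
move=> [mf _] [mg _] fg; congr fine; apply: ae_eq_integral => //.
- exact/measurable_EFinP.
- exact/measurable_EFinP.
- by apply: filterS fg => x -> _.
Qed.

Lemma int0_ae0 f : bmf f -> (forall x, 0 <= f x) -> \int[mu]_x f x <= 0 ->
  {ae mu, forall x, f x = 0}.
Proof.
move=> bf f0 If; have mEf : measurable_fun setT (EFin \o f).
  by apply/measurable_EFinP; case: bf.
have [+ _] := ae_eq_integral_abs mu measurableT mEf.
have -> : (\int[mu]_x `|(EFin \o f) x| = 0)%E.
  under eq_integral do rewrite /= ger0_norm//.
  rewrite -EFin_Rintegral//; congr EFin.
  by apply/eqP; rewrite eq_le If int_ge0.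
move=> /(_ erefl); apply: filterS => x /(_ I)[].
by move=> /= [].
Qed.

Lemma bmf_dominated (u : (X -> R)^nat) f M :
  (forall n, measurable_fun setT (u n)) -> measurable_fun setT f ->
  (forall n x, `|u n x| <= M) ->
  {ae mu, forall x, u ^~ x @ \oo --> f x} ->
  (\int[mu]_x u n x) @[n --> \oo] --> \int[mu]_x f x.
Proof.
move=> mu_ mf uM uf.
have mEu n : measurable_fun setT (EFin \o u n) by exact/measurable_EFinP.
have mEf : measurable_fun setT (EFin \o f) by exact/measurable_EFinP.
have uf' : {ae mu, forall x, setT x ->
    (EFin \o u n) x @[n --> \oo] --> (EFin \o f) x}.
  by apply: filterS uf => x ufx _; apply: cvg_EFin; [exact: nearW | exact: ufx].
have M_int : mu.-integrable setT (EFin \o cst M).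
  exact: bmf_integrable (bmf_cst X M).
have uM' : {ae mu, forall x n, setT x ->
    (`|(EFin \o u n) x| <= (EFin \o cst M) x)%E}.
  by apply: aeW => x n _ /=; rewrite lee_fin.
have [f_int _ cv] := dominated_convergence measurableT mEu mEf uf' M_int uM'.
apply: fine_cvg.
by rewrite [X in _ --> X]fineK ?(integrable_fin_num measurableT).
Qed.

End BoundedIntegral.

(** * Integration over a product of two finite measure spaces *)

Section ProductMeasure.
Context (R : realType) (dX dY : measure_display).
Context (X : measurableType dX) (Y : measurableType dY).
Variable mu : {finite_measure set X -> \bar R}.
Variable nu : {finite_measure set Y -> \bar R}.

(** A name of its own for the product measure, to carry its finiteness. *)
Definition fin_prod : set (X * Y) -> \bar R := (mu \x nu)%E.

HB.instance Definition _ := Measure.on fin_prod.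

Let fin_prod_fin : fin_num_fun fin_prod.
Proof.
apply: lty_fin_num_fun; rewrite -setXTT [ltLHS]product_measure1E//.
by rewrite lte_mul_pinfty// ?finite_measure_lty// fin_num_measure.
Qed.

HB.instance Definition _ := Measure_isFinite.Build _ _ _ fin_prod fin_prod_fin.

Definition prod_measure : {finite_measure set (X * Y)%type -> \bar R} :=
  fin_prod.

End ProductMeasure.

Section Product.
Context (R : realType) (dX dY : measure_display).
Context (X : measurableType dX) (Y : measurableType dY).
Variable mu : {finite_measure set X -> \bar R}.
Variable nu : {finite_measure set Y -> \bar R}.
Local Notation pi := (prod_measure mu nu).
Implicit Types f : X * Y -> R.

Lemma bmf_int2 f : bmf f -> bmf (fun x => \int[nu]_y f (x, y)).
Proof.
move=> bf; have bfx x : bmf (fun y => f (x, y)) by exact: bmf_pair1.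
split.
  apply/measurable_EFinP.
  apply: (eq_measurable_fun (fubini_F nu (EFin \o f))).
    by move=> x _; rewrite /= (EFin_Rintegral _ (bfx x)).
  (* any finite measure would do as the first factor *)
  exact: (measurable_fubini_F (bmf_integrable (prod_measure mzero nu) bf)).
have [_ [M fM]] := bf; exists (M * fine (nu setT)) => x.
rewrite -Rintegral_cst//; apply: le_trans.
  by apply: le_normr_Rintegral => //; exact: bmf_integrable.
apply: bmf_le_int => [||y]; [|exact: bmf_cst|exact: fM].
split; first by apply: measurableT_comp => //; exact: (bfx x).1.
by exists M => y; rewrite normr_id.
Qed.

Lemma bmf_int1 f : bmf f -> bmf (fun y => \int[mu]_x f (x, y)).
Proof.
move=> bf; have bfy y : bmf (fun x => f (x, y)) by exact: bmf_pair2.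
split.
  apply/measurable_EFinP.
  apply: (eq_measurable_fun (fubini_G mu (EFin \o f))).
    by move=> y _; rewrite /= (EFin_Rintegral _ (bfy y)).
  exact: (measurable_fubini_G (bmf_integrable (prod_measure mu mzero) bf)).
have [_ [M fM]] := bf; exists (M * fine (mu setT)) => y.
rewrite -Rintegral_cst//; apply: le_trans.
  by apply: le_normr_Rintegral => //; exact: bmf_integrable.
apply: bmf_le_int => [||x]; [|exact: bmf_cst|exact: fM].
split; first by apply: measurableT_comp => //; exact: (bfy y).1.
by exists M => x; rewrite normr_id.
Qed.

Lemma int_prod12 f : bmf f ->
  \int[pi]_p f p = \int[mu]_x \int[nu]_y f (x, y).
Proof.
move=> bf; congr fine; rewrite /=.
rewrite -(integral12_prod_meas1 (bmf_integrable pi bf)).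
apply: eq_integral => x _; rewrite EFin_Rintegral//; exact: bmf_pair1.
Qed.

Lemma int_prod21 f : bmf f ->
  \int[pi]_p f p = \int[nu]_y \int[mu]_x f (x, y).
Proof.
move=> bf; congr fine; rewrite /=.
rewrite -(integral21_prod_meas1 (bmf_integrable pi bf)).
apply: eq_integral => y _; rewrite EFin_Rintegral//; exact: bmf_pair2.
Qed.

Lemma int_swap f : bmf f ->
  \int[mu]_x \int[nu]_y f (x, y) = \int[nu]_y \int[mu]_x f (x, y).
Proof. by move=> bf; rewrite -int_prod12// int_prod21. Qed.

(** Almost all sections of a null set of the product are null, since the measure
    of a section is a nonnegative function with integral 0. *)
Lemma ae_prod (P : X * Y -> Prop) : {ae pi, forall p, P p} ->
  {ae mu, forall x, {ae nu, forall y, P (x, y)}} /\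
  {ae nu, forall y, {ae mu, forall x, P (x, y)}}.
Proof.
move=> [N [mN N0 PN]]; have bN := bmf_indic R mN.
have intN : \int[pi]_p (\1_N p : R) <= 0 by rewrite int_indic// N0.
split.
- have [] := int0_ae0 (mu := mu) (bmf_int2 bN) _ _.
  + by move=> x; apply: int_ge0 => y; rewrite indicE.
  + by rewrite -int_prod12.
  move=> N1 [mN1 N10 PN1]; exists N1; split => // x Px; apply: PN1 => /= intx.
  apply: Px; exists (xsection N x); split; first exact: measurable_xsection.
  + have mNx := measurable_xsection x mN.
    apply/eqP; rewrite -fine_eq0 ?fin_num_measure// -int_indic//.
    rewrite -intx; apply/eqP; apply: eq_Rintegral => y _.
    by rewrite !indicE mem_xsection.
  + by move=> y /PN; rewrite /xsection/= inE.
- have [] := int0_ae0 (mu := nu) (bmf_int1 bN) _ _.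
  + by move=> y; apply: int_ge0 => x; rewrite indicE.
  + by rewrite -int_prod21.
  move=> N1 [mN1 N10 PN1]; exists N1; split => // y Py; apply: PN1 => /= inty.
  apply: Py; exists (ysection N y); split; first exact: measurable_ysection.
  + have mNy := measurable_ysection y mN.
    apply/eqP; rewrite -fine_eq0 ?fin_num_measure// -int_indic//.
    rewrite -inty; apply/eqP; apply: eq_Rintegral => x _.
    by rewrite !indicE mem_ysection.
  + by move=> x /PN; rewrite /ysection/= inE.
Qed.

Lemma marginal_cvg (u : (X * Y -> R)^nat) f M :
  (forall n, measurable_fun setT (u n)) -> measurable_fun setT f ->
  (forall n p, `|u n p| <= M) ->
  {ae pi, forall p, u ^~ p @ \oo --> f p} ->
  {ae mu, forall x,
    (\int[nu]_y u n (x, y)) @[n --> \oo] --> \int[nu]_y f (x, y)} /\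
  {ae nu, forall y,
    (\int[mu]_x u n (x, y)) @[n --> \oo] --> \int[mu]_x f (x, y)}.
Proof.
move=> mu_ mf uM /ae_prod[uf1 uf2]; split.
- apply: filterS uf1 => x; apply: (bmf_dominated (M := M)) => //.
  + by move=> n; apply: measurableT_comp => //; exact: pair1_measurable.
  + by apply: measurableT_comp => //; exact: pair1_measurable.
- apply: filterS uf2 => y.
  apply: (bmf_dominated (u := fun n x => u n (x, y)) (M := M)) => //.
  + by move=> n; apply: measurableT_comp => //; exact: pair2_measurable.
  + by apply: measurableT_comp => //; exact: pair2_measurable.
Qed.

End Product.

(** * Attained minima without weak compactness *)

Section AttainedMinimum.
Context (R : realType) (d : measure_display) (X : measurableType d).
Variable mu : {finite_measure set X -> \bar R}.

Definition dyadic (n : nat) : R := (2 ^ n.+1)%:R^-1.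
Local Notation e := dyadic.

Let e_gt0 n : 0 < e n.
Proof. by rewrite /dyadic invr_gt0 ltr0n expn_gt0. Qed.

Let e_decr n : e n.+1 <= e n.
Proof.
by rewrite /dyadic lef_pV2 ?posrE ?ltr0n ?expn_gt0// ler_nat leq_exp2l.
Qed.

Let e_cvg0 : e @ \oo --> (0 : R).
Proof.
suff -> : e = geometric 2^-1 2^-1.
  by apply: cvg_geometric; rewrite ger0_norm; lra.
by apply/funext => n; rewrite /dyadic /= natrX -exprVn exprS.
Qed.

(** Squared L2 steps of size at most a constant times 4^-n give L1 steps of size
    at most a constant times 2^-n. Hence the sum of the absolute steps has
    finite integral, is finite almost everywhere, and there the sequence
    converges. *)
Lemma ae_cvg_of_L2_fast (u : (X -> R)^nat) (C : R) : (forall n, bmf (u n)) ->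
  (forall n, \int[mu]_x (u n.+1 x - u n x) ^+ 2 <= C * e n ^+ 2) ->
  exists f : X -> R,
    measurable_fun setT f /\ {ae mu, forall x, u ^~ x @ \oo --> f x}.
Proof.
move=> bu uC.
pose g n x : R := `|u n.+1 x - u n x|.
have bh n : bmf (fun x => u n.+1 x - u n x) by apply: bmfD => //; exact: bmfN.
have bg n : bmf (g n).
  have [mh [M hM]] := bh n; split; first exact: measurableT_comp.
  by exists M => x; rewrite normr_id.
have mEg n : measurable_fun setT (EFin \o g n).
  by apply/measurable_EFinP; exact: (bg n).1.
pose I1 : R := \int[mu]_x (1 : R).
have I1_ge0 : 0 <= I1 by apply: int_ge0.
have C_ge0 : 0 <= C.
  have := le_trans (int_ge0 mu (fun x => sqr_ge0 (u 1 x - u 0 x))) (uC 0%N).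
  by rewrite pmulr_lge0// exprn_gt0.
have Ig n : \int[mu]_x g n x <= (C + I1) * e n.
  apply: (@le_trans _ _
      (\int[mu]_x ((e n)^-1 * (u n.+1 x - u n x) ^+ 2 + e n * 1))).
    apply: bmf_le_int => [||x].
    - solve_bmf.
    - solve_bmf.
    (* |h| <= h^2 / e + e, whatever the positive number e *)
    rewrite -(ler_pM2l (e_gt0 n)) mulrDr mulrA divff ?gt_eqF// mul1r mulr1.
    rewrite /g -real_normK ?num_real//.
    have := sqr_ge0 (`|u n.+1 x - u n x| - e n); have := e_gt0 n.
    have := normr_ge0 (u n.+1 x - u n x); nra.
  rewrite bmf_intD; try solve_bmf.
  rewrite !bmf_intZ; try solve_bmf.
  rewrite mulrDl (mulrC I1) lerD2r ler_pdivrMl//.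
  by rewrite (le_trans (uC n))// expr2 mulrCA.
have sum_lty : (\int[mu]_x (\sum_(0 <= k <oo) (g k x)%:E) < +oo)%E.
  rewrite integral_nneseries//=; last first.
    by move=> n x _; rewrite lee_fin; exact: normr_ge0.
  apply: (@le_lt_trans _ _ (C + I1)%:E); last exact: ltry.
  apply: le_trans (epsilon_trick0 xpredT (addr_ge0 C_ge0 I1_ge0)).
  apply: lee_nneseries => [n _ _|n _].
    by apply: integral_ge0 => x _; rewrite lee_fin; exact: normr_ge0.
  by rewrite -EFin_Rintegral// lee_fin.
have mS : measurable_fun setT (fun x => \sum_(0 <= k <oo) (g k x)%:E)%E.
  apply: ge0_emeasurable_sum => [k x _ _|k _]; last exact: mEg.
  by rewrite lee_fin; exact: normr_ge0.
have S_int : mu.-integrable setT (fun x => \sum_(0 <= k <oo) (g k x)%:E)%E.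
  apply/integrableP; split => //; apply: le_lt_trans sum_lty.
  rewrite le_eqVlt; apply/orP; left; apply/eqP; apply: eq_integral => x _.
  apply: gee0_abs; apply: nneseries_ge0 => n _ _.
  by rewrite lee_fin; exact: normr_ge0.
exists (fun x => fine (limn_esup (fun n => (u n x)%:E))); split.
  apply: measurableT_comp => //; apply: measurable_fun_limn_esup => n.
  by apply/measurable_EFinP; exact: (bu n).1.
have := integrable_ae measurableT S_int; apply: filterS => x /(_ I) Sfin.
have cu : cvgn (u ^~ x).
  have -> : u ^~ x = (fun n => u 0%N x + series (telescope (u ^~ x)) n).
    by apply/funext => n; rewrite -eq_sum_telescope.
  apply: is_cvgD; first exact: is_cvg_cst.
  apply: normed_cvg; apply: nondecreasing_is_cvgn.
    by apply: nondecreasing_series => n _ _; exact: normr_ge0.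
  exists (fine (\sum_(0 <= k <oo) (g k x)%:E)%E) => _ [n _ <-].
  rewrite -lee_fin fineK//; apply: le_trans (nneseries_lim_ge n _) => //.
    by rewrite /series /= sumEFin.
  by move=> k _ _; rewrite lee_fin; exact: normr_ge0.
have cEu : (fun n => (u n x)%:E) @ \oo --> (limn (u ^~ x))%:E.
  by apply: cvg_EFin; [exact: nearW | exact: cu].
by rewrite (cvg_limn_einf_sup cEu).2.
Qed.

Variable e0 : X -> R.
Hypothesis be0 : bmf e0.

Definition midpoint (f g : X -> R) x : R := (f x + g x) / 2.

(** The sets [L eps] of the near-minimizers shrink with [eps], so the infimum [D
    eps] of the squared L2 norm over them increases to a limit [DD]. Take in
    each of them a function whose norm is nearly minimal. The midpoint of two
    such functions is again a near-minimizer, so its norm is nearly at least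
    [DD], and the parallelogram identity makes the two functions close to each
    other. This replaces the weak compactness of [K], and yields an almost
    everywhere limit. *)
Lemma attained_minimum (K : set (X -> R)) (Phi : (X -> R) -> R) (B : R) :
    K !=set0 ->
    (forall f, K f -> measurable_fun setT f /\ forall x, 0 <= f x <= e0 x) ->
    (forall f g, K f -> K g -> K (midpoint f g)) ->
    (forall (u : (X -> R)^nat) (f : X -> R), (forall n, K (u n)) ->
      measurable_fun setT f -> (forall x, 0 <= f x <= e0 x) ->
      {ae mu, forall x, u ^~ x @ \oo --> f x} ->
      K f /\ Phi (u n) @[n --> \oo] --> Phi f) ->
    (forall f g, K f -> K g -> Phi (midpoint f g) <= Num.max (Phi f) (Phi g)) ->
    (forall f, K f -> B <= Phi f) ->
  exists2 f, K f & forall g, K g -> Phi f <= Phi g.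
Proof.
move=> [k0 Kk0] Kbox Kmid Kclosed Phimid PhiB.
have Kb f : K f -> bmf f by move=> /Kbox[mf fe]; exact: bmf_ge0_le be0 fe.
pose m := inf (Phi @` K).
have PhiK_inf : has_inf (Phi @` K).
  by split; [exists (Phi k0), k0 | exists B => _ [f Kf <-]; exact: PhiB].
have mPhi f : K f -> m <= Phi f.
  by move=> Kf; apply: ge_inf PhiK_inf.2 _ _; exists f.
pose L (eps : R) : set (X -> R) := [set f | K f /\ Phi f <= m + eps].
pose nrm (f : X -> R) : R := \int[mu]_x (f x) ^+ 2.
pose D (eps : R) := inf (nrm @` L eps).
have L_neq0 eps : 0 < eps -> L eps !=set0.
  move=> eps0; have [_ [f Kf <-] /ltW fm] := inf_adherent eps0 PhiK_inf.
  by exists f.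
have nrm_inf eps : 0 < eps -> has_inf (nrm @` L eps).
  move=> /L_neq0[f Lf]; split; first by exists (nrm f), f.
  by exists 0 => _ [h _ <-]; apply: int_ge0 => x; exact: sqr_ge0.
have D_le eps f : 0 < eps -> L eps f -> D eps <= nrm f.
  by move=> eps0 Lf; apply: ge_inf (nrm_inf _ eps0).2 _ _; exists f.
pose DD := sup (D @` [set eps | 0 < eps]).
have DD_sup : has_sup (D @` [set eps | 0 < eps]).
  split; first by exists (D 1), 1 => //=.
  exists (nrm e0) => _ [eps eps0 <-]; have [f [Kf fm]] := L_neq0 _ eps0.
  apply: (le_trans (D_le _ _ eps0 (conj Kf fm))).
  apply: bmf_le_int => [||x]; [exact/bmfX/Kb|exact: bmfX|].
  have [_ /(_ x)/andP[f0 fe]] := Kbox _ Kf.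
  by rewrite ler_sqr ?nnegrE// (le_trans f0).
have D_DD eps : 0 < eps -> D eps <= DD.
  by move=> eps0; apply: sup_upper_bound => //; exists eps.
have D_anti a b : 0 < a -> a <= b -> D b <= D a.
  move=> a0 ab; have [f Lf] := L_neq0 _ a0.
  apply: lb_le_inf; first by exists (nrm f), f.
  move=> _ [h [Kh hm] <-]; apply: D_le; first exact: lt_le_trans ab.
  by split => //; rewrite (le_trans hm)// lerD2l.
(* the n-th pair is a tolerance and a function within this tolerance *)
have /choice[w wP] (n : nat) : exists p : R * (X -> R),
    [/\ 0 < p.1 <= e n, DD - e n ^+ 2 <= D p.1, L p.1 p.2
      & nrm p.2 <= DD + e n ^+ 2].
  have en2 : 0 < e n ^+ 2 by rewrite exprn_gt0.
  have [_ [eps /= eps0 <-] Deps] := sup_adherent en2 DD_sup.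
  pose a := Num.min eps (e n).
  have a0 : 0 < a by rewrite lt_min eps0 e_gt0.
  have [_ [f Lf <-] fD] := inf_adherent en2 (nrm_inf _ a0).
  exists (a, f); split => //=.
  - by rewrite a0 ge_min lexx orbT.
  - by rewrite (le_trans (ltW Deps))// D_anti// ge_min lexx.
  - by rewrite (le_trans (ltW fD))// lerD2r D_DD.
pose u n := (w n).2.
have Ku n : K (u n) by have [_ _ []] := wP n.
have bu n : bmf (u n) by exact: Kb.
have [f [mf uf]] : exists f : X -> R,
    measurable_fun setT f /\ {ae mu, forall x, u ^~ x @ \oo --> f x}.
  apply: (ae_cvg_of_L2_fast (C := 8)) => // n.
  have [/andP[a0 ae] aD [Ku0 Pu0] un] := wP n.
  have [/andP[b0 be] bD [Ku1 Pu1] un1] := wP n.+1.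
  have e2 : e n.+1 ^+ 2 <= e n ^+ 2.
    by have := e_decr n; have := e_gt0 n.+1; nra.
  have midD : DD - e n ^+ 2 <= nrm (midpoint (u n) (u n.+1)).
    have Lmid : L (Num.max (w n).1 (w n.+1).1) (midpoint (u n) (u n.+1)).
      split; first exact: Kmid.
      apply: (le_trans (Phimid _ _ (Ku n) (Ku n.+1))).
      rewrite ge_max; apply/andP; split.
      - by rewrite (le_trans Pu0)// lerD2l le_max lexx.
      - by rewrite (le_trans Pu1)// lerD2l le_max lexx orbT.
    apply: le_trans (D_le _ _ _ Lmid); last by rewrite lt_max a0.
    by case: (leP (w n).1 (w n.+1).1) => _ //; rewrite (le_trans _ bD)// lerB.
  (* parallelogram identity *)
  have -> : \int[mu]_x (u n.+1 x - u n x) ^+ 2 =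
      2 * nrm (u n) + 2 * nrm (u n.+1) - 4 * nrm (midpoint (u n) (u n.+1)).
    rewrite /nrm /midpoint -!bmf_intZ; try solve_bmf.
    rewrite -bmf_intD; try solve_bmf.
    rewrite -bmf_intB; try solve_bmf.
    by apply: eq_Rintegral => x _; field.
  move: un un1 midD; rewrite -/(u n) -/(u n.+1); lra.
(* clipping enforces the bounds everywhere, and changes f on a null set *)
pose f' x := Num.max 0 (Num.min (f x) (e0 x)).
have e0_ge0 x : 0 <= e0 x.
  by have [_ /(_ x)/andP[]] := Kbox _ Kk0; exact: le_trans.
have mf' : measurable_fun setT f'.
  apply: measurable_maxr; first exact: measurable_cst.
  by apply: measurable_minr => //; exact: be0.1.
have f'e x : 0 <= f' x <= e0 x.
  by rewrite /f' le_max lexx ge_max e0_ge0 ge_min lexx orbT.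
have uf' : {ae mu, forall x, u ^~ x @ \oo --> f' x}.
  apply: filterS uf => x ux; suff -> : f' x = f x by [].
  have f0 : 0 <= f x.
    apply: (cvgr_to_ge ux); apply: nearW => n.
    by have [_ /(_ x)/andP[]] := Kbox _ (Ku n).
  have fe : f x <= e0 x.
    apply: (cvgr_to_le ux); apply: nearW => n.
    by have [_ /(_ x)/andP[]] := Kbox _ (Ku n).
  by rewrite /f' (min_idPl fe) (max_idPr f0).
have [Kf' Phiu] := Kclosed _ _ Ku mf' f'e uf'.
exists f' => // h Kh; apply: le_trans (mPhi _ Kh).
have me_cvg : m + e n @[n --> \oo] --> m.
  by rewrite -[X in _ --> X]addr0; apply: cvgD; [exact: cvg_cst|exact: e_cvg0].
apply: (ler_cvg_to Phiu me_cvg); apply: nearW => n.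
have [/andP[_ ae] _ [_ Pu] _] := wP n.
by rewrite (le_trans Pu)// lerD2l.
Qed.

End AttainedMinimum.

(** * Functions with prescribed marginals *)

Section Marginals.
Context (R : realType) (dX dY : measure_display).
Context (X : measurableType dX) (Y : measurableType dY).
Variable mu : {finite_measure set X -> \bar R}.
Variable nu : {finite_measure set Y -> \bar R}.
Local Notation pi := (prod_measure mu nu).
Implicit Types f g q : X * Y -> R.

Definition marg1 f (x : X) : R := \int[nu]_y f (x, y).
Definition marg2 f (y : Y) : R := \int[mu]_x f (x, y).

Lemma bmf_marg1 f : bmf f -> bmf (marg1 f).
Proof. exact: bmf_int2. Qed.

Lemma bmf_marg2 f : bmf f -> bmf (marg2 f).
Proof. exact: bmf_int1. Qed.

Lemma marg1_lin f g (r : R) x : bmf f -> bmf g ->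
  marg1 (fun p => f p + r * g p) x = marg1 f x + r * marg1 g x.
Proof.
by move=> bf bg; rewrite /marg1 -bmf_intZ ?bmf_intD//; solve_bmf.
Qed.

Lemma marg2_lin f g (r : R) y : bmf f -> bmf g ->
  marg2 (fun p => f p + r * g p) y = marg2 f y + r * marg2 g y.
Proof.
by move=> bf bg; rewrite /marg2 -bmf_intZ ?bmf_intD//; solve_bmf.
Qed.

Lemma int_marg1 f (h : X -> R) : bmf f -> bmf h ->
  \int[mu]_x (h x * marg1 f x) = \int[pi]_p (h p.1 * f p).
Proof.
move=> bf bh; rewrite int_prod12; last solve_bmf.
by apply: eq_Rintegral => x _; rewrite /= bmf_intZ//; solve_bmf.
Qed.

Lemma int_marg2 f (h : Y -> R) : bmf f -> bmf h ->
  \int[nu]_y (h y * marg2 f y) = \int[pi]_p (h p.2 * f p).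
Proof.
move=> bf bh; rewrite int_prod21; last solve_bmf.
by apply: eq_Rintegral => y _; rewrite /= bmf_intZ//; solve_bmf.
Qed.

Definition between0 (e : X * Y -> R) : set (X * Y -> R) :=
  [set f : X * Y -> R | measurable_fun setT f /\ forall p, 0 <= f p <= e p].

Lemma between0_bmf e f : bmf e -> between0 e f -> bmf f.
Proof. by move=> be [mf fe]; exact: bmf_ge0_le be fe. Qed.

Lemma between0_midpoint e f g :
  between0 e f -> between0 e g -> between0 e (midpoint f g).
Proof.
move=> [mf fe] [mg ge]; split => [|p].
  apply: measurable_funM; last exact: measurable_cst.
  exact: measurable_funD.
by have := fe p; have := ge p; rewrite /midpoint; lra.
Qed.

Lemma midpointE f g : midpoint f g = (fun p => 2^-1 * f p + 2^-1 * g p).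
Proof. by apply/funext => p; rewrite /midpoint; field. Qed.

Lemma marg1_midpoint f g : bmf f -> bmf g ->
  marg1 (midpoint f g) = midpoint (marg1 f) (marg1 g).
Proof.
move=> bf bg; rewrite midpointE; apply/funext => x.
rewrite marg1_lin//; last by solve_bmf.
rewrite /marg1 bmf_intZ /midpoint; last by solve_bmf.
by field.
Qed.

Lemma marg2_midpoint f g : bmf f -> bmf g ->
  marg2 (midpoint f g) = midpoint (marg2 f) (marg2 g).
Proof.
move=> bf bg; rewrite midpointE; apply/funext => y.
rewrite marg2_lin//; last by solve_bmf.
rewrite /marg2 bmf_intZ /midpoint; last by solve_bmf.
by field.
Qed.

Lemma between0_marg_cvg e (u : (X * Y -> R)^nat) f : bmf e ->
  (forall n, between0 e (u n)) -> between0 e f ->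
  {ae pi, forall p, u ^~ p @ \oo --> f p} ->
  {ae mu, forall x, marg1 (u n) x @[n --> \oo] --> marg1 f x} /\
  {ae nu, forall y, marg2 (u n) y @[n --> \oo] --> marg2 f y}.
Proof.
move=> [_ [M eM]] ue [mf _]; apply: (marginal_cvg (M := M)) => // [n|n p].
  exact: (ue n).1.
have /andP[u0 uep] := (ue n).2 p.
by rewrite ger0_norm// (le_trans uep)// (le_trans (ler_norm _)).
Qed.

End Marginals.

Ltac solve_bmf ::= solve [repeat first
  [ exact: bmf_cst | solve [auto] | apply: bmfN | apply: bmfX | apply: bmfM
  | apply: bmfD | apply: bmf_fst | apply: bmf_snd | apply: bmf_pair1
  | apply: bmf_pair2 | apply: bmf_marg1 | apply: bmf_marg2 ]].

Lemma marg_between (R : realType) d (X : measurableType d)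
    (mu : {finite_measure set X -> \bar R}) (f g : X -> R) :
  bmf f -> bmf g -> (forall x, 0 <= f x <= g x) ->
  0 <= \int[mu]_x f x <= \int[mu]_x g x.
Proof.
move=> bf bg fg; rewrite int_ge0 => [|x]; last by have /andP[] := fg x.
by apply: bmf_le_int => // x; have /andP[] := fg x.
Qed.

Lemma sq_residual_cvg (R : realType) d (X : measurableType d)
    (mu : {finite_measure set X -> \bar R}) (c E m : X -> R)
    (u : (X -> R)^nat) :
  bmf c -> bmf E -> bmf m -> (forall n, bmf (u n)) ->
  (forall n x, 0 <= u n x <= E x) ->
  {ae mu, forall x, u n x @[n --> \oo] --> m x} ->
  \int[mu]_x (c x - u n x) ^+ 2 @[n --> \oo] --> \int[mu]_x (c x - m x) ^+ 2.
Proof.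
move=> bc bE bm bu uE um.
have [_ [C cC]] := bc; have [_ [D ED]] := bE.
apply: (bmf_dominated (M := (C + D) ^+ 2)) => [n||n x|].
- by have [] : bmf (fun x => (c x - u n x) ^+ 2) by solve_bmf.
- by have [] : bmf (fun x => (c x - m x) ^+ 2) by solve_bmf.
- rewrite normrX ler_sqr ?nnegrE//; last first.
    by apply: le_trans (lerD (cC x) (ED x)); rewrite addr_ge0.
  rewrite (le_trans (ler_normB _ _))// lerD//.
  have /andP[u0 ux] := uE n x.
  by rewrite ger0_norm// (le_trans ux)// (le_trans (ler_norm _)).
- apply: filterS um => x um; rewrite !expr2.
  by apply: cvgM; apply: cvgB => //; exact: cvg_cst.
Qed.

Lemma sq_residual_midpoint (R : realType) d (X : measurableType d)
    (mu : {finite_measure set X -> \bar R}) (c f g : X -> R) :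
  bmf c -> bmf f -> bmf g ->
  \int[mu]_x (c x - midpoint f g x) ^+ 2 <=
  2^-1 * \int[mu]_x (c x - f x) ^+ 2 + 2^-1 * \int[mu]_x (c x - g x) ^+ 2.
Proof.
move=> bc bf bg; rewrite -!bmf_intZ; try solve_bmf.
rewrite -bmf_intD; try solve_bmf.
apply: bmf_le_int => [||x]; [rewrite /midpoint; solve_bmf|solve_bmf|].
by rewrite /midpoint; have := sqr_ge0 (f x - g x); nra.
Qed.

Lemma le0_of_quadratic (R : realType) (S C : R) :
  (forall t, 0 <= t <= 1 -> 2 * t * S <= t ^+ 2 * C) -> S <= 0.
Proof.
move=> SC; rewrite leNgt; apply/negP => S0.
have C2 : 2 * S <= C by have := SC 1; rewrite ler01 lexx expr1n; lra.
have C0 : 0 < C by lra.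
have SC0 : 0 < S / C by rewrite divr_gt0.
have SC1 : S / C <= 1 by rewrite ler_pdivrMr//; lra.
have := SC (S / C); rewrite (ltW SC0) SC1 => /(_ isT).
have -> : (S / C) ^+ 2 * C = S * (S / C) by field; rewrite gt_eqF.
by nra.
Qed.

(** * A fractional solution, by least squares *)

Lemma measurable_gt0 (R : realType) d (X : measurableType d) (f : X -> R) :
  measurable_fun setT f -> measurable [set x | 0 < f x].
Proof.
move=> mf; have := mf measurableT _ (measurable_itv `]0, +oo[).
rewrite setTI; congr measurable.
by apply/seteqP; split => x /=; rewrite in_itv/= andbT.
Qed.

Lemma measurable_ge0 (R : realType) d (X : measurableType d) (f : X -> R) :
  measurable_fun setT f -> measurable [set x | 0 <= f x].
Proof.
move=> mf; have := mf measurableT _ (measurable_itv `[0, +oo[).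
rewrite setTI; congr measurable.
by apply/seteqP; split => x /=; rewrite in_itv/= andbT.
Qed.

Lemma indic_bool (R : realType) (X : Type) (P : pred X) x :
  \1_[set x | P x] x = (P x)%:R :> R.
Proof.
by rewrite indicE; congr (nat_of_bool _)%:R; apply/idP/idP; rewrite inE.
Qed.

Lemma avg_le_max (R : realType) (r t : R) :
  2^-1 * r + 2^-1 * t <= Num.max r t.
Proof. by rewrite le_max; case: (leP r t) => ?; apply/orP; [right|left]; lra. Qed.

Section FractionalSolution.
Context (R : realType) (dX dY : measure_display).
Context (X : measurableType dX) (Y : measurableType dY).
Variable mu : {finite_measure set X -> \bar R}.
Variable nu : {finite_measure set Y -> \bar R}.
Local Notation pi := (prod_measure mu nu).
Local Notation marg1 := (marg1 nu).
Local Notation marg2 := (marg2 mu).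
Variables (e : X * Y -> R) (c : X -> R) (b : Y -> R).
Hypotheses (be : bmf e) (bc : bmf c) (bb : bmf b).
Hypothesis e_ge0 : forall p, 0 <= e p.

Definition defect (f : X * Y -> R) : R :=
  \int[mu]_x (c x - marg1 f x) ^+ 2 + \int[nu]_y (b y - marg2 f y) ^+ 2.

Lemma defect_min : exists2 f, between0 e f &
  forall g, between0 e g -> defect f <= defect g.
Proof.
have bK f := @between0_bmf _ _ _ X Y e f be.
have marg1e f : between0 e f -> forall x, 0 <= marg1 f x <= marg1 e x.
  move=> Kf x; have bf := bK _ Kf.
  by apply: marg_between => [||y]; [solve_bmf|solve_bmf|exact: Kf.2].
have marg2e f : between0 e f -> forall y, 0 <= marg2 f y <= marg2 e y.
  move=> Kf y; have bf := bK _ Kf.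
  by apply: marg_between => [||x]; [solve_bmf|solve_bmf|exact: Kf.2].
apply: (attained_minimum (mu := pi) (B := 0) be).
- exists (fun=> 0); split => [|p]; first exact: measurable_cst.
  by rewrite lexx e_ge0.
- by [].
- exact: between0_midpoint.
- move=> u f Ku mf fe uf; have Kf : between0 e f by [].
  have bf := bK _ Kf; have bu n := bK _ (Ku n).
  have [cv1 cv2] := between0_marg_cvg be Ku Kf uf.
  split => //; apply: cvgD.
  + apply: (sq_residual_cvg (E := marg1 e)) => //; try solve_bmf.
    by move=> n; solve_bmf.
  + apply: (sq_residual_cvg (E := marg2 e)) => //; try solve_bmf.
    by move=> n; solve_bmf.
- move=> f g /bK bf /bK bg.
  rewrite [X in X <= _]/defect marg1_midpoint// marg2_midpoint//.
  have b1 (f' : X * Y -> R) : bmf f' -> bmf (marg1 f') by move=> ?; solve_bmf.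
  have b2 (f' : X * Y -> R) : bmf f' -> bmf (marg2 f') by move=> ?; solve_bmf.
  have h1 := sq_residual_midpoint mu bc (b1 _ bf) (b1 _ bg).
  have h2 := sq_residual_midpoint nu bb (b2 _ bf) (b2 _ bg).
  have avg : \int[mu]_x (c x - midpoint (marg1 f) (marg1 g) x) ^+ 2 +
      \int[nu]_y (b y - midpoint (marg2 f) (marg2 g) y) ^+ 2 <=
      2^-1 * defect f + 2^-1 * defect g.
    by rewrite /defect !mulrDr addrACA lerD.
  exact: le_trans avg (avg_le_max _ _).
- by move=> f _; rewrite addr_ge0// int_ge0// => z; exact: sqr_ge0.
Qed.

Lemma defect_lin f g t : bmf f -> bmf g ->
  defect (fun p => f p + t * g p) = defect f
    - 2 * t * \int[pi]_p ((c p.1 - marg1 f p.1 + (b p.2 - marg2 f p.2)) * g p)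
    + t ^+ 2 * (\int[mu]_x marg1 g x ^+ 2 + \int[nu]_y marg2 g y ^+ 2).
Proof.
move=> bf bg.
have -> : \int[pi]_p ((c p.1 - marg1 f p.1 + (b p.2 - marg2 f p.2)) * g p) =
    \int[mu]_x ((c x - marg1 f x) * marg1 g x) +
    \int[nu]_y ((b y - marg2 f y) * marg2 g y).
  rewrite (int_marg1 mu nu bg (h := fun x => c x - marg1 f x)); last by solve_bmf.
  rewrite (int_marg2 mu nu bg (h := fun y => b y - marg2 f y)); last by solve_bmf.
  rewrite -bmf_intD.
  - by apply: eq_Rintegral => p _; rewrite mulrDl.
  - solve_bmf.
  - solve_bmf.
have -> : defect (fun p => f p + t * g p) =
    \int[mu]_x ((c x - marg1 f x) ^+ 2 - 2 * t * ((c x - marg1 f x) * marg1 g x)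
      + t ^+ 2 * marg1 g x ^+ 2) +
    \int[nu]_y ((b y - marg2 f y) ^+ 2 - 2 * t * ((b y - marg2 f y) * marg2 g y)
      + t ^+ 2 * marg2 g y ^+ 2).
  congr (_ + _).
    by apply: eq_Rintegral => x _; rewrite marg1_lin//; ring.
  by apply: eq_Rintegral => y _; rewrite marg2_lin//; ring.
rewrite !bmf_intD; try solve_bmf.
rewrite !bmf_intN; try solve_bmf.
rewrite !bmf_intZ; try solve_bmf.
rewrite /defect; ring.
Qed.


(** First order condition. Where both missing amounts [u] and [v] are on the
    same side (one of them strictly), moving [f] toward the corresponding bound,
    [e] or 0, decreases the defect unless [f] is already equal to that bound. *)
Lemma defect_min_saturates f : between0 e f ->
    (forall g, between0 e g -> defect f <= defect g) ->
  {ae pi, forall p,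
    (0 < b p.2 - marg2 f p.2 -> 0 <= c p.1 - marg1 f p.1 -> f p = e p) /\
    (b p.2 - marg2 f p.2 <= 0 -> c p.1 - marg1 f p.1 < 0 -> f p = 0)}.
Proof.
move=> Kf fmin; have bf := between0_bmf be Kf.
pose u x := c x - marg1 f x; pose v y := b y - marg2 f y.
have bu : bmf u by rewrite /u; solve_bmf.
have bv : bmf v by rewrite /v; solve_bmf.
pose U := [set x | 0 <= u x]; pose A := [set y | 0 < v y].
have b1U : bmf (\1_U : X -> R).
  by apply: bmf_indic; apply: measurable_ge0; case: bu.
have b1A : bmf (\1_A : Y -> R).
  by apply: bmf_indic; apply: measurable_gt0; case: bv.
pose q p : R := \1_A p.2 * \1_U p.1 * (e p - f p)
              - (1 - \1_A p.2) * (1 - \1_U p.1) * f p.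
have bq : bmf q by rewrite /q; solve_bmf.
(* q moves f to e where v > 0 and u >= 0, and to 0 where v <= 0 and u < 0 *)
have Kfq t : 0 <= t <= 1 -> between0 e (fun p => f p + t * q p).
  move=> /andP[t0 t1]; split => [|p].
    by have [] : bmf (fun p => f p + t * q p) by solve_bmf.
  have /andP[f0 fe] := Kf.2 p.
  rewrite /q !indic_bool.
  by case: (ltP 0 (v p.2)); case: (leP 0 (u p.1)) => /= _ _; nra.
pose S := \int[pi]_p ((u p.1 + v p.2) * q p).
have S_le0 : S <= 0.
  apply: (@le0_of_quadratic _ _
    (\int[mu]_x marg1 q x ^+ 2 + \int[nu]_y marg2 q y ^+ 2)) => t t01.
  by have := fmin _ (Kfq t t01); rewrite (defect_lin t bf bq) -/S; lra.
have uvq0 p : 0 <= (u p.1 + v p.2) * q p.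
  have /andP[f0 fe] := Kf.2 p.
  rewrite /q !indic_bool.
  by case: (ltP 0 (v p.2)); case: (leP 0 (u p.1)) => /=; nra.
have buvq : bmf (fun p => (u p.1 + v p.2) * q p) by solve_bmf.
have := int0_ae0 buvq uvq0 S_le0; apply: filterS => p /eqP.
rewrite mulf_eq0 /q !indic_bool => /orP uvq.
split=> [vp up|vp up]; rewrite -/(v p.2) -/(u p.1) in vp up; move: uvq.
- by rewrite vp up /= => -[/eqP|/eqP]; lra.
- by rewrite ltNge vp leNgt up /= => -[/eqP|/eqP]; lra.
Qed.

(** Let [f] minimize the defect, let [u] and [v] be the missing row and column
    amounts, and apply the cut condition to [A = {v > 0}], with [c] in the
    minimum over [{u < 0}] and the degree over [U = {u >= 0}]. By the first
    order condition [f] fills [U * A] completely and vanishes on the product of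
    the complements, so that the capacity of [U * A] can be computed from the
    marginals of [f]. What is left is that the integral of [v] over [A] is at
    most the integral of [u] over [{u < 0}], hence both are 0. As [u] and [v]
    have equal integrals, [u >= 0 >= v] forces both to vanish. *)
Theorem fractional_solution :
    \int[nu]_y b y = \int[mu]_x c x ->
    (forall A : set Y, measurable A ->
      \int[nu]_y (\1_A y * b y) <=
      \int[mu]_x Num.min (c x) (\int[nu]_y (\1_A y * e (x, y)))) ->
  exists f, [/\ between0 e f, {ae mu, forall x, marg1 f x = c x} &
    {ae nu, forall y, marg2 f y = b y}].
Proof.
move=> bc_eq cut; have [f Kf fmin] := defect_min.
have bf := between0_bmf be Kf; have sat := defect_min_saturates Kf fmin.
exists f; pose u x := c x - marg1 f x; pose v y := b y - marg2 f y.
have bu : bmf u by rewrite /u; solve_bmf.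
have bv : bmf v by rewrite /v; solve_bmf.
pose U := [set x | 0 <= u x]; pose A := [set y | 0 < v y].
have mA : measurable A by apply: measurable_gt0; case: bv.
have b1U : bmf (\1_U : X -> R).
  by apply: bmf_indic; apply: measurable_ge0; case: bu.
have b1A : bmf (\1_A : Y -> R) by apply: bmf_indic.
have intu : \int[mu]_x u x = \int[mu]_x c x - \int[pi]_p f p.
  by rewrite int_prod12// -bmf_intB//; solve_bmf.
have intv : \int[nu]_y v y = \int[mu]_x c x - \int[pi]_p f p.
  by rewrite int_prod21// -bc_eq -bmf_intB//; solve_bmf.
have key : \int[nu]_y (\1_A y * v y) <= \int[mu]_x ((1 - \1_U x) * u x).
  have bA (x : X) : bmf (fun y => \1_A y * e (x, y)) by solve_bmf.
  have bmin : bmf (fun x => Num.min (c x) (\int[nu]_y (\1_A y * e (x, y)))).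
    apply: bmf_min => //.
    by have : bmf (marg1 (fun p => \1_A p.2 * e p)) by solve_bmf.
  have cutA : \int[nu]_y (\1_A y * b y) <=
      \int[mu]_x ((1 - \1_U x) * c x)
      + \int[pi]_p (\1_U p.1 * (\1_A p.2 * e p)).
    apply: (le_trans (cut A mA)).
    rewrite -(int_marg1 mu nu (f := fun p => \1_A p.2 * e p)); try solve_bmf.
    rewrite -bmf_intD; try solve_bmf.
    apply: bmf_le_int => [||x]; [solve_bmf|solve_bmf|].
    rewrite indic_bool ge_min /marg1 /=; case: (leP 0 (u x)) => _ /=.
      by apply/orP; right; lra.
    by apply/orP; left; lra.
  have sat1 : \int[pi]_p (\1_U p.1 * (\1_A p.2 * e p)) =
      \int[pi]_p (\1_U p.1 * (\1_A p.2 * f p)).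
    apply: ae_eq_int; try solve_bmf.
    apply: filterS sat => p [fe _]; rewrite !indic_bool.
    case: (leP 0 (u p.1)) => up; case: (ltP 0 (v p.2)) => vp;
      rewrite ?mul0r ?mulr0//.
    by rewrite fe.
  have sat2 : \int[pi]_p ((1 - \1_U p.1) * f p) =
      \int[pi]_p ((1 - \1_U p.1) * (\1_A p.2 * f p)).
    apply: ae_eq_int; try solve_bmf.
    apply: filterS sat => p [_ f0]; rewrite !indic_bool.
    case: (leP 0 (u p.1)) => up; case: (ltP 0 (v p.2)) => vp;
      rewrite ?subrr ?mul0r ?mulr0 ?mul1r//.
    by rewrite f0// mulr0.
  have split1 : \int[pi]_p (\1_U p.1 * (\1_A p.2 * f p)) =
      \int[pi]_p (\1_A p.2 * f p)
      - \int[pi]_p ((1 - \1_U p.1) * (\1_A p.2 * f p)).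
    rewrite -bmf_intB; try solve_bmf.
    by apply: eq_Rintegral => p _; ring.
  have intA : \int[pi]_p (\1_A p.2 * f p) =
      \int[nu]_y (\1_A y * b y) - \int[nu]_y (\1_A y * v y).
    rewrite -(int_marg2 mu nu (f := f)) -?bmf_intB//; try solve_bmf.
    by apply: eq_Rintegral => y _; rewrite /v; ring.
  have intU : \int[pi]_p ((1 - \1_U p.1) * f p) =
      \int[mu]_x ((1 - \1_U x) * c x) - \int[mu]_x ((1 - \1_U x) * u x).
    rewrite -(int_marg1 mu nu (f := f) (h := fun x => 1 - \1_U x)) -?bmf_intB//;
      try solve_bmf.
    by apply: eq_Rintegral => x _; rewrite /u; ring.
  move: cutA; rewrite sat1 split1 -sat2 intA intU; lra.
have Av0 y : 0 <= \1_A y * v y.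
  by rewrite indic_bool; case: (ltP 0 (v y)) => /= ?; lra.
have Uu0 x : 0 <= - ((1 - \1_U x) * u x).
  by rewrite indic_bool; case: (leP 0 (u x)) => /= ?; lra.
have IAv := int_ge0 nu Av0; have IUu := int_ge0 mu Uu0.
move: IUu; rewrite bmf_intN => [IUu|]; last solve_bmf.
have intuE : \int[mu]_x u x =
    \int[mu]_x (\1_U x * u x) + \int[mu]_x ((1 - \1_U x) * u x).
  rewrite -bmf_intD; try solve_bmf.
  by apply: eq_Rintegral => x _; ring.
have intvE : \int[nu]_y v y =
    \int[nu]_y (\1_A y * v y) - \int[nu]_y ((1 - \1_A y) * - v y).
  rewrite -bmf_intB; try solve_bmf.
  by apply: eq_Rintegral => y _; ring.
have U1u0 x : 0 <= \1_U x * u x.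
  by rewrite indic_bool; case: (leP 0 (u x)) => /= ?; lra.
have A1v0 y : 0 <= (1 - \1_A y) * - v y.
  by rewrite indic_bool; case: (ltP 0 (v y)) => /= ?; lra.
have IU1u := int_ge0 mu U1u0; have IA1v := int_ge0 nu A1v0.
split => //.
- have h1 : {ae mu, forall x, \1_U x * u x = 0}.
    by apply: int0_ae0 => //; [solve_bmf|lra].
  have h2 : {ae mu, forall x, - ((1 - \1_U x) * u x) = 0}.
    by apply: int0_ae0 => //; [solve_bmf|rewrite bmf_intN; [lra|solve_bmf]].
  by apply: filterS2 h1 h2 => x; rewrite /u; lra.
- have h1 : {ae nu, forall y, \1_A y * v y = 0}.
    by apply: int0_ae0 => //; [solve_bmf|lra].
  have h2 : {ae nu, forall y, (1 - \1_A y) * - v y = 0}.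
    by apply: int0_ae0 => //; [solve_bmf|lra].
  by apply: filterS2 h1 h2 => y; rewrite /v; lra.
Qed.

End FractionalSolution.

(** * A gainful perturbation with zero marginals *)

Section Moments.
Context (R : realType) (d : measure_display) (X : measurableType d).
Variable mu : {finite_measure set X -> \bar R}.
Variables (q x : X -> R).
Hypotheses (bq : bmf q) (bx : bmf x) (q_ge0 : forall s, 0 <= q s).

Definition moment i : R := \int[mu]_s (q s * x s ^+ i).

Lemma moment_variance m :
  \int[mu]_s (q s * (x s - m) ^+ 2) =
  moment 2 - 2 * m * moment 1 + m ^+ 2 * moment 0.
Proof.
rewrite /moment -!bmf_intZ; try solve_bmf.
rewrite -bmf_intB; try solve_bmf.
rewrite -bmf_intD; try solve_bmf.
by apply: eq_Rintegral => s _; ring.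
Qed.

Lemma moment0_eq0 i : moment 0 <= 0 -> moment i = 0.
Proof.
move=> M0; have q0 : {ae mu, forall s, q s * x s ^+ 0 = 0}.
  apply: int0_ae0 M0; first solve_bmf.
  by move=> s; rewrite expr0 mulr1.
have <- : \int[mu]_s 0 = 0 :> R by rewrite Rintegral_cst// mul0r.
rewrite /moment; apply: ae_eq_int; try solve_bmf.
by apply: filterS q0 => s; rewrite expr0 mulr1 => ->; rewrite mul0r.
Qed.

Lemma moment0_ge0 : 0 <= moment 0.
Proof. by apply: int_ge0 => s; rewrite expr0 mulr1. Qed.

Lemma moment_gap : 0 < moment 0 ->
  moment 2 * moment 0 - moment 1 ^+ 2 =
  moment 0 * \int[mu]_s (q s * (x s - moment 1 / moment 0) ^+ 2).
Proof. by move=> M0; rewrite moment_variance; field; rewrite gt_eqF. Qed.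

(** The gap is the total weight times the weighted integral of the squared
    deviation of [x] from its mean. *)
Lemma moment_cauchy_schwarz : 0 <= moment 2 * moment 0 - moment 1 ^+ 2.
Proof.
have [M0|M0] := ltP 0 (moment 0).
  rewrite moment_gap//; apply: mulr_ge0; [exact: ltW|apply: int_ge0 => s].
  by rewrite mulr_ge0// sqr_ge0.
by rewrite !(moment0_eq0 _ M0) mulr0 expr0n subrr.
Qed.

(** A variable of variance 0 is constant on the weighted part of the space, but
    [x] has null fibres. *)
Lemma moment_cauchy_schwarz_eq : (forall a, {ae mu, forall s, x s <> a}) ->
  moment 2 * moment 0 - moment 1 ^+ 2 = 0 -> moment 0 = 0.
Proof.
move=> x_diffuse gap0; apply/eqP; rewrite eq_le moment0_ge0 andbT leNgt.
apply/negP => M0; move: gap0; rewrite moment_gap// => /eqP.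
rewrite mulf_eq0 gt_eqF//= => /eqP var0.
have q0 : {ae mu, forall s, q s * (x s - moment 1 / moment 0) ^+ 2 = 0}.
  apply: int0_ae0; [solve_bmf|by move=> s; rewrite mulr_ge0// sqr_ge0|].
  by rewrite var0.
have : moment 0 = \int[mu]_s 0.
  rewrite /moment; apply: ae_eq_int; try solve_bmf.
  apply: filterS2 (x_diffuse (moment 1 / moment 0)) q0 => s xs /eqP.
  rewrite mulf_eq0 sqrf_eq0 subr_eq0 => /orP[/eqP ->|/eqP//].
  by rewrite mul0r.
rewrite Rintegral_cst// mul0r.
by move=> M00; rewrite M00 ltxx in M0.
Qed.

End Moments.

Lemma int2_antisym (R : realType) d (Y : measurableType d)
    (nu : {finite_measure set Y -> \bar R}) (a : Y * Y -> R) :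
  bmf a -> (forall t t', a (t', t) = - a (t, t')) ->
  \int[nu]_t \int[nu]_t' a (t, t') = 0.
Proof.
move=> ba anti; have := int_swap nu nu ba.
under [RHS]eq_Rintegral do under eq_Rintegral do rewrite anti.
under [RHS]eq_Rintegral do (rewrite bmf_intN; last by solve_bmf).
by rewrite bmf_intN; [lra|exact: bmf_int2].
Qed.

Section Perturbation.
Context (R : realType) (dX dY : measure_display).
Context (X : measurableType dX) (Y : measurableType dY).
Variable mu : {finite_measure set X -> \bar R}.
Variable nu : {finite_measure set Y -> \bar R}.
Local Notation pi := (prod_measure mu nu).
Variables (p : X * Y -> R) (x : X -> R) (y : Y -> R).
Hypotheses (bp : bmf p) (bx : bmf x) (b_y : bmf y).
Hypothesis p_ge0 : forall z, 0 <= p z.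

Lemma bmf_pair (d : measure_display) (Z : measurableType d)
    (f : X * Y -> R) (g : Z -> X) (h : Z -> Y) :
  measurable_fun setT g -> measurable_fun setT h -> bmf f ->
  bmf (fun z => f (g z, h z)).
Proof. by move=> mg mh; apply: bmf_comp; exact: measurable_fun_pair. Qed.

Definition comoment i (t : Y * Y) : R :=
  moment mu (fun s => p (s, t.1) * p (s, t.2)) x i.

Let bmf_comoment_integrand i :
  bmf (fun w : X * (Y * Y) => p (w.1, w.2.1) * p (w.1, w.2.2) * x w.1 ^+ i).
Proof.
have m1 : measurable_fun setT (fun w : X * (Y * Y) => w.1).
  exact: measurable_fst.
have m2 : measurable_fun setT (fun w : X * (Y * Y) => w.2.1).
  by apply: measurableT_comp; [exact: measurable_fst|exact: measurable_snd].
have m3 : measurable_fun setT (fun w : X * (Y * Y) => w.2.2).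
  by apply: measurableT_comp; [exact: measurable_snd|exact: measurable_snd].
apply: bmfM; last by solve_bmf.
by apply: bmfM; apply: bmf_pair.
Qed.

Lemma bmf_comoment i : bmf (comoment i).
Proof. exact: bmf_int1 (bmf_comoment_integrand i). Qed.

Lemma comomentC i t t' : comoment i (t', t) = comoment i (t, t').
Proof. by apply: eq_Rintegral => s _ /=; rewrite (mulrC (p (s, t'))). Qed.

(** Write [k(s, s', t, t') = (x s' - x s) * (y t' - y t)]. The perturbation at
    [(s, t)] is the integral over [s'] and [t'] of [k] weighted by [p] at the
    other three corners of the rectangle with corners [(s, t)] and [(s', t')];
    the integral over [s'] has already been expressed with the moments of [x].
    Multiplied by [p (s, t)], it adds and removes mass at the corners of
    rectangles alternately, because [k] changes sign when [s] and [s'] or [t]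
    and [t'] are exchanged. *)
Definition perturbation_kernel (w : X * Y * Y) : R :=
  p (w.1.1, w.2) * (y w.2 - y w.1.2) *
  (comoment 1 (w.1.2, w.2) - x w.1.1 * comoment 0 (w.1.2, w.2)).

Definition perturbation (z : X * Y) : R :=
  \int[nu]_t' perturbation_kernel (z, t').

Lemma bmf_perturbation_kernel : bmf perturbation_kernel.
Proof.
have m11 : measurable_fun setT (fun w : X * Y * Y => w.1.1).
  by apply: measurableT_comp; [exact: measurable_fst|exact: measurable_fst].
have m12 : measurable_fun setT (fun w : X * Y * Y => w.1.2).
  by apply: measurableT_comp; [exact: measurable_snd|exact: measurable_fst].
have m2 : measurable_fun setT (fun w : X * Y * Y => w.2).
  exact: measurable_snd.
have b0 i : bmf (fun w : X * Y * Y => comoment i (w.1.2, w.2)).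
  apply: bmf_comp (bmf_comoment i); exact: measurable_fun_pair.
have b1 : bmf (fun w : X * Y * Y => y w.1.2) by exact: bmf_comp b_y.
have b2 : bmf (fun w : X * Y * Y => x w.1.1) by exact: bmf_comp bx.
have b3 : bmf (fun w : X * Y * Y => p (w.1.1, w.2)) by exact: bmf_pair.
by rewrite /perturbation_kernel; solve_bmf.
Qed.

Lemma bmf_perturbation : bmf perturbation.
Proof. exact: bmf_int2 bmf_perturbation_kernel. Qed.

Let bk := bmf_perturbation_kernel.
Let bpsi := bmf_perturbation.
Let bc := bmf_comoment.

(** For a fixed [s], the integrand is antisymmetric in [t] and [t']. *)
Lemma perturbation_marg1 s : \int[nu]_t (p (s, t) * perturbation (s, t)) = 0.
Proof.
pose a (t : Y * Y) : R := p (s, t.1) * perturbation_kernel ((s, t.1), t.2).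
have ba : bmf a.
  apply: bmfM.
    exact: bmf_pair.
  apply: bmf_comp bk; by do 2 apply: measurable_fun_pair => //.
rewrite -[RHS](int2_antisym nu ba).
  by apply: eq_Rintegral => t _; rewrite /a /= bmf_intZ//; exact: bmf_pair1.
by move=> t t'; rewrite /a /perturbation_kernel /= !(comomentC _ t t'); ring.
Qed.

(** The inner integral over [s] only involves moments of [x]; the case [i = 0]
    gives the second marginal, the case [i = 1] the gain. *)
Lemma perturbation_col i t :
  \int[mu]_s (x s ^+ i * (p (s, t) * perturbation (s, t))) =
  \int[nu]_t' ((y t' - y t) * (comoment 1 (t, t') * comoment i (t, t')
                               - comoment 0 (t, t') * comoment i.+1 (t, t'))).
Proof.
pose a (z : X * Y) : R :=
  x z.1 ^+ i * (p (z.1, t) * perturbation_kernel ((z.1, t), z.2)).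
have ba : bmf a.
  apply: bmfM; first by solve_bmf.
  apply: bmfM.
    exact: bmf_pair.
  apply: bmf_comp bk; by do 2 apply: measurable_fun_pair => //.
transitivity (\int[mu]_s \int[nu]_t' a (s, t')).
  apply: eq_Rintegral => s _.
  have bks : bmf (fun t' => perturbation_kernel (s, t, t')).
    exact: bmf_pair1.
  by rewrite /a /= !bmf_intZ//; solve_bmf.
rewrite (int_swap mu nu ba); apply: eq_Rintegral => t' _.
have bpp j : bmf (fun s => p (s, t) * p (s, t') * x s ^+ j) by solve_bmf.
set M1 := comoment 1 _; set M0 := comoment 0 _.
rewrite /comoment /moment /= -(bmf_intZ _ M1)// -(bmf_intZ _ M0)//.
rewrite -bmf_intB; try solve_bmf.
rewrite -bmf_intZ; try solve_bmf.
apply: eq_Rintegral => s _.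
by rewrite /a /perturbation_kernel /= -/M1 -/M0 exprS; ring.
Qed.


Lemma perturbation_marg2 t : \int[mu]_s (p (s, t) * perturbation (s, t)) = 0.
Proof.
have := perturbation_col 0 t.
under eq_Rintegral do rewrite expr0 mul1r.
move=> ->; under eq_Rintegral do rewrite [X in _ * (X - _)]mulrC subrr mulr0.
by rewrite Rintegral_cst// mul0r.
Qed.

Definition comoment_gap (t : Y * Y) : R :=
  comoment 2 t * comoment 0 t - comoment 1 t ^+ 2.

Lemma bmf_comoment_gap : bmf comoment_gap.
Proof. by rewrite /comoment_gap; solve_bmf. Qed.

Lemma comoment_gap_ge0 t : 0 <= comoment_gap t.
Proof.
apply: moment_cauchy_schwarz => [||s]; [solve_bmf|by []|].
exact: mulr_ge0.
Qed.

(** Symmetrizing in [t] and [t'] turns the gain into the integral of a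
    nonnegative function. *)
Lemma perturbation_gain :
  2 * \int[pi]_z (x z.1 * y z.2 * (p z * perturbation z)) =
  \int[prod_measure nu nu]_t ((y t.1 - y t.2) ^+ 2 * comoment_gap t).
Proof.
have bgap := bmf_comoment_gap.
pose B (t : Y * Y) : R := y t.1 * ((y t.2 - y t.1) *
  (comoment 1 t * comoment 1 t - comoment 0 t * comoment 2 t)).
have bB : bmf B by rewrite /B; solve_bmf.
pose G (t : Y * Y) : R := (y t.1 - y t.2) ^+ 2 * comoment_gap t.
have bG : bmf G by rewrite /G; solve_bmf.
have -> : \int[pi]_z (x z.1 * y z.2 * (p z * perturbation z)) =
    \int[prod_measure nu nu]_t B t.
  rewrite int_prod21; last by solve_bmf.
  rewrite int_prod12//; apply: eq_Rintegral => t _; rewrite /B /=.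
  have bct i : bmf (fun t' => comoment i (t, t')) by exact: bmf_pair1 (bc i).
  rewrite bmf_intZ; last by solve_bmf.
  have bpt : bmf (fun s => perturbation (s, t)) by exact: bmf_pair2.
  transitivity (y t * \int[mu]_s (x s ^+ 1 * (p (s, t) * perturbation (s, t)))).
    rewrite -bmf_intZ; last by solve_bmf.
    by apply: eq_Rintegral => s _; rewrite expr1; ring.
  by congr (_ * _); exact: perturbation_col.
have anti : \int[nu]_t \int[nu]_t' (2 * B (t, t') - G (t, t')) = 0.
  apply: (int2_antisym nu (a := fun t => 2 * B t - G t)); first by solve_bmf.
  move=> t t'; rewrite /B /G /comoment_gap /= !(comomentC _ t t'); ring.
apply/eqP; rewrite -subr_eq0 -anti -bmf_intZ//.
rewrite -bmf_intB//; last by solve_bmf.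
by rewrite int_prod12//; solve_bmf.
Qed.

(** When the gain is not positive, the gap vanishes for almost all pairs [t],
    [t'] with [y t <> y t'], hence for almost all pairs. By the equality case of
    Cauchy-Schwarz almost no two columns of [p] overlap. The total overlap is
    the integral of the squared row sums of [p], so [p] vanishes. *)
Lemma perturbation_gain_le0 :
    (forall a, {ae mu, forall s, x s <> a}) ->
    (forall a, {ae nu, forall t, y t <> a}) ->
    \int[pi]_z (x z.1 * y z.2 * (p z * perturbation z)) <= 0 ->
  {ae pi, forall z, p z = 0}.
Proof.
move=> x_diffuse y_diffuse gain_le0.
have bgap := bmf_comoment_gap.
have bG : bmf (fun t => (y t.1 - y t.2) ^+ 2 * comoment_gap t) by solve_bmf.
have G0 t : 0 <= (y t.1 - y t.2) ^+ 2 * comoment_gap t.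
  by rewrite mulr_ge0 ?sqr_ge0 ?comoment_gap_ge0.
have GI0 : \int[prod_measure nu nu]_t
    ((y t.1 - y t.2) ^+ 2 * comoment_gap t) <= 0.
  by rewrite -perturbation_gain; lra.
have [aeG _] := ae_prod (int0_ae0 bG G0 GI0).
have C00 : {ae nu, forall t, {ae nu, forall t', comoment 0 (t, t') = 0}}.
  apply: filterS aeG => t aeGt.
  apply: filterS2 (y_diffuse (y t)) aeGt => t' yt' /eqP.
  rewrite mulf_eq0 sqrf_eq0 subr_eq0 /= => /orP[/eqP/esym//|/eqP].
  apply: moment_cauchy_schwarz_eq => // [|s]; first by solve_bmf.
  exact: mulr_ge0.
have int_comoment0 : \int[prod_measure nu nu]_t comoment 0 t = 0.
  rewrite int_prod12//.
  have : {ae nu, forall t, \int[nu]_t' comoment 0 (t, t') = 0}.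
    apply: filterS C00 => t C0t.
    have <- : \int[nu]_(t' in setT) 0 = 0 :> R by rewrite Rintegral_cst// mul0r.
    by apply: ae_eq_int => //; solve_bmf.
  move=> inner0; have <- : \int[nu]_(t' in setT) 0 = 0 :> R.
    by rewrite Rintegral_cst// mul0r.
  by apply: ae_eq_int => //; [exact: bmf_int2|solve_bmf].
pose m s : R := \int[nu]_t p (s, t).
have bm : bmf m by exact: bmf_int2.
have m2 : \int[mu]_s (m s ^+ 2) = \int[prod_measure nu nu]_t comoment 0 t.
  rewrite /comoment /moment.
  rewrite -(int_swap mu (prod_measure nu nu) (bmf_comoment_integrand 0)).
  apply: eq_Rintegral => s _ /=.
  under [RHS]eq_Rintegral do rewrite expr0 mulr1.
  have bps : bmf (fun t => p (s, t)) by exact: bmf_pair1.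
  have bps1 : bmf (fun t : Y * Y => p (s, t.1)) := bmf_fst _ bps.
  have bps2 : bmf (fun t : Y * Y => p (s, t.2)) := bmf_snd _ bps.
  rewrite int_prod12 /=; last by solve_bmf.
  under [RHS]eq_Rintegral do rewrite bmf_intZ//.
  under [RHS]eq_Rintegral do rewrite mulrC.
  by rewrite bmf_intZ.
have m_ae0 : {ae mu, forall s, m s = 0}.
  have : {ae mu, forall s, m s ^+ 2 = 0}.
    apply: int0_ae0; [solve_bmf|by move=> s; exact: sqr_ge0|].
    by rewrite m2 int_comoment0.
  by apply: filterS => s /eqP; rewrite sqrf_eq0 => /eqP.
apply: int0_ae0 => //; rewrite int_prod12//.
have <- : \int[mu]_(s in setT) 0 = 0 :> R by rewrite Rintegral_cst// mul0r.
rewrite le_eqVlt; apply/orP; left; apply/eqP.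
by apply: ae_eq_int => //; solve_bmf.
Qed.

End Perturbation.

(** * Extremal solutions take only their extreme values *)

Section ExtremalSolution.
Context (R : realType) (dX dY : measure_display).
Context (X : measurableType dX) (Y : measurableType dY).
Variable mu : {finite_measure set X -> \bar R}.
Variable nu : {finite_measure set Y -> \bar R}.
Local Notation pi := (prod_measure mu nu).
Variables (e : X * Y -> R) (c : X -> R) (b : Y -> R).
Hypothesis be : bmf e.

Definition solutions : set (X * Y -> R) := [set f | [/\ between0 e f,
  {ae mu, forall x, marg1 nu f x = c x} &
  {ae nu, forall y, marg2 mu f y = b y}]].

Lemma solutions_midpoint f g :
  solutions f -> solutions g -> solutions (midpoint f g).
Proof.
move=> [Kf f1 f2] [Kg g1 g2].
have bf := between0_bmf be Kf; have bg := between0_bmf be Kg.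
split; first exact: between0_midpoint.
- rewrite marg1_midpoint//.
  by apply: filterS2 f1 g1 => x; rewrite /midpoint => -> ->; field.
- rewrite marg2_midpoint//.
  by apply: filterS2 f2 g2 => x; rewrite /midpoint => -> ->; field.
Qed.

Lemma solutions_closed (u : (X * Y -> R)^nat) f :
  (forall n, solutions (u n)) -> between0 e f ->
  {ae pi, forall p, u ^~ p @ \oo --> f p} -> solutions f.
Proof.
move=> Su Kf uf; have Ku n : between0 e (u n) by have [] := Su n.
have [cv1 cv2] := between0_marg_cvg be Ku Kf uf.
have unique (v : R^nat) (l r : R) :
    v @ \oo --> l -> (forall n, v n = r) -> l = r.
  move=> vl vr; have vE : v = cst r by apply/funext.
  by rewrite vE in vl; exact: cvg_unique vl (cvg_cst _).
split=> //.
- have /ae_foralln u1 n : {ae mu, forall x, marg1 nu (u n) x = c x}.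
    by have [] := Su n.
  by apply: filterS2 cv1 u1 => x cv; exact: unique cv.
- have /ae_foralln u2 n : {ae nu, forall y, marg2 mu (u n) y = b y}.
    by have [] := Su n.
  by apply: filterS2 cv2 u2 => x cv; exact: unique cv.
Qed.

Lemma solutions_argmax (w : X * Y -> R) : bmf w -> solutions !=set0 ->
  exists2 f, solutions f & forall g, solutions g ->
    \int[pi]_z (w z * g z) <= \int[pi]_z (w z * f z).
Proof.
move=> bw S0; have [_ [W wW]] := bw; have [_ [M eM]] := be.
have bS f : solutions f -> bmf f by move=> [Kf _ _]; exact: between0_bmf be Kf.
pose Phi f := - \int[pi]_z (w z * f z).
have [||||f Sf fmin] := @attained_minimum _ _ _ pi e be solutions Phi
  (- \int[pi]_z (W * e z)) S0 _ solutions_midpoint.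
- by move=> f [[mf fe] _ _].
- move=> u f Su mf fe uf; split; first exact: solutions_closed Su _ uf.
  apply: cvgN; have bf : bmf f by exact: bmf_ge0_le be fe.
  have bu n := bS _ (Su n).
  apply: (bmf_dominated (M := W * M)) => [n||n z|].
  + by have [] : bmf (fun z => w z * u n z) by solve_bmf.
  + by have [] : bmf (fun z => w z * f z) by solve_bmf.
  + have [[_ /(_ z)/andP[u0 ue]] _ _] := Su n.
    rewrite normrM ler_pM// ger0_norm// (le_trans ue)//.
    exact: le_trans (ler_norm _) (eM z).
  + by apply: filterS uf => z uz; apply: cvgM uz; exact: cvg_cst.
- move=> f g /bS bf /bS bg.
  have -> : Phi (midpoint f g) = 2^-1 * Phi f + 2^-1 * Phi g.
    rewrite /Phi /midpoint !mulrN -opprD -!bmf_intZ; try solve_bmf.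
    rewrite -bmf_intD; try solve_bmf.
    by congr (- _); apply: eq_Rintegral => z _; field.
  exact: avg_le_max.
- move=> f Sf; have bf := bS _ Sf; rewrite /Phi lerN2.
  apply: bmf_le_int => [||z]; [solve_bmf|solve_bmf|].
  have [[_ /(_ z)/andP[f0 fe]] _ _] := Sf.
  have ww : w z <= W by exact: le_trans (ler_norm _) (wW z).
  apply: (@le_trans _ _ (W * f z)); first by rewrite ler_wpM2r.
  by rewrite ler_wpM2l// (le_trans _ (wW z)).
- by exists f => // g /fmin; rewrite /Phi lerN2.
Qed.

(** Maximize the integral of [x s * y t * f (s, t)] over the solutions, and use
    [p = f * (e - f)] in the perturbation. This weight keeps small multiples of
    the perturbation between 0 and [e], so that the gain cannot be positive. *)
Lemma extremal_solution (x : X -> R) (y : Y -> R) :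
    bmf x -> bmf y ->
    (forall a, {ae mu, forall s, x s <> a}) ->
    (forall a, {ae nu, forall t, y t <> a}) ->
    solutions !=set0 ->
  exists2 f, solutions f & {ae pi, forall z, f z * (e z - f z) = 0}.
Proof.
move=> bx b_y x_diffuse y_diffuse S0.
have bw : bmf (fun z : X * Y => x z.1 * y z.2) by solve_bmf.
have [f Sf fmax] := solutions_argmax bw S0; exists f => //.
have [Kf f1 f2] := Sf; have bf := between0_bmf be Kf.
pose p z := f z * (e z - f z).
have bp : bmf p by rewrite /p; solve_bmf.
have p_ge0 z : 0 <= p z.
  by have /andP[f0 fe] := Kf.2 z; rewrite mulr_ge0// subr_ge0.
apply: (perturbation_gain_le0 bp bx b_y p_ge0 x_diffuse y_diffuse).
set psi := perturbation mu nu p x y.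
have bpsi : bmf psi by exact: bmf_perturbation.
have [_ [C psiC]] := bpsi; have [_ [M eM]] := be.
have C0 : 0 <= `|C| by [].
have M0 : 0 <= `|M| by [].
pose t := ((`|C| + 1) * (`|M| + 1))^-1.
have t_gt0 : 0 < t by rewrite invr_gt0 mulr_gt0// ltr_wpDl.
pose q z := p z * psi z.
have bq : bmf q by rewrite /q; solve_bmf.
have Kg : between0 e (fun z => f z + t * q z).
  split => [|z]; first by have [] : bmf (fun z => f z + t * q z) by solve_bmf.
  have /andP[f0 fe] := Kf.2 z.
  have e_ge0 : 0 <= e z by exact: le_trans fe.
  pose r := t * psi z.
  have re : `|r| * e z <= 1.
    rewrite /r normrM (gtr0_norm t_gt0) -mulrA /t mulrC.
    rewrite ler_pdivrMr ?mul1r; last by rewrite mulr_gt0// ltr_wpDl.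
    apply: ler_pM => //.
      by rewrite (le_trans (psiC z))// (le_trans (ler_norm C))// lerDl.
    rewrite (le_trans (ler_norm _))// (le_trans (eM z))//.
    by rewrite (le_trans (ler_norm M))// lerDl.
  have r0 := normr_ge0 r.
  have /andP[r1 r2] : - `|r| <= r <= `|r| by rewrite -ler_norml.
  have -> : t * q z = f z * (e z - f z) * r by rewrite /q /p /r; ring.
  have h1 : - 1 <= r * (e z - f z) by nra.
  have h2 : r * f z <= 1 by nra.
  by apply/andP; split; nra.
have Sg : solutions (fun z => f z + t * q z).
  split => //.
  - apply: filterS f1 => s <-; rewrite marg1_lin// [X in t * X]/marg1 /q.
    by rewrite perturbation_marg1// mulr0 addr0.
  - apply: filterS f2 => s <-; rewrite marg2_lin// [X in t * X]/marg2 /q.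
    by rewrite perturbation_marg2// mulr0 addr0.
have := fmax _ Sg; rewrite -/q => gain.
have : t * \int[pi]_z (x z.1 * y z.2 * q z) <= 0.
  rewrite -(lerD2l (\int[pi]_z (x z.1 * y z.2 * f z))) addr0.
  rewrite -bmf_intZ -?bmf_intD; try solve_bmf.
  apply: le_trans gain; rewrite le_eqVlt; apply/orP; left; apply/eqP.
  by apply: eq_Rintegral => z _; ring.
by rewrite pmulr_rle0.
Qed.

End ExtremalSolution.

(** * A function with null fibres on a standard measure space *)

(** The sets are the preimages of the balls of radius [1 / (k + 1)] around the
    points of a countable dense set, numbered by pairs of a point and a [k]. *)
Lemma standard_borel_separating (R : realType) d (T : measurableType d) :
  standard_borel R T ->
  exists U : (set T)^nat, (forall n, measurable (U n)) /\
    forall s s', s <> s' -> exists n, U n s /\ ~ U n s'.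
Proof.
move=> [X [_ [D /countable_injP[g g_inj] D_dense] [f [f_bij fP]]]].
pose B (i k : nat) : set X :=
  [set z | exists2 a, D a /\ g a = i & mdist a z < k.+1%:R^-1].
have B_open i k : open (B i k).
  rewrite openE => z [a [Da gai] az]; apply/nbhs_ballP.
  exists (k.+1%:R^-1 - mdist a z) => /=; first by rewrite subr_gt0.
  move=> w; rewrite ballEmdist /= => zw; exists a => //.
  by rewrite (le_lt_trans (metric_triangle _ z _))// -ltrBrDl.
pose U n : set T :=
  if unpickle n is Some ik then f @^-1` B ik.1 ik.2 else set0.
exists U; split=> [n|s s' ss'].
  rewrite /U; case: unpickle => [ik|]; last exact: measurable0.
  by apply/fP; apply: sub_sigma_algebra; exact: B_open.
have dist0 : 0 < mdist (f s) (f s').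
  by rewrite mdist_gt0; apply/eqP => /(bij_inj f_bij).
have [k ks] : exists k, k.+1%:R^-1 < mdist (f s) (f s') / 2.
  have d2 : 0 < mdist (f s) (f s') / 2 by rewrite divr_gt0.
  have [k kP] := ltr_add_invr d2; exists k.
  by rewrite add0r in kP.
have [a [a_ball Da]] : (ball (f s) k.+1%:R^-1)° `&` D !=set0.
  apply: D_dense; last exact: open_interior.
  by exists (f s); apply: nbhsx_ballx; rewrite invr_gt0.
have {a_ball} : ball (f s) k.+1%:R^-1 a by exact: interior_subset a_ball.
rewrite ballEmdist /= => as_lt; rewrite metric_sym in as_lt.
exists (pickle (g a, k)); rewrite /U pickleK /=; split; first by exists a.
move=> [a' [Da' ga'] a's']; have aa' : a' = a by apply: g_inj; rewrite ?inE.
rewrite aa' /= in a's'.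
have := metric_triangle (f s) a (f s').
rewrite [mdist (f s) a]metric_sym => tri.
have := lt_trans (le_lt_trans tri (ltrD as_lt a's')) (ltrD ks ks).
by rewrite -splitr ltxx.
Qed.

Section DiffuseFunction.
Context (R : realType) (d : measure_display) (T : measurableType d).
Variable U : (set T)^nat.
Hypothesis mU : forall n, measurable (U n).

Let S (N : nat) (s : T) : R := \sum_(k < N) 3^-1 ^+ k * \1_(U k) s.

Let w_gt0 n : 0 < 3^-1 ^+ n :> R.
Proof. by rewrite exprn_gt0. Qed.

Let S_nondecr s : nondecreasing_seq (S ^~ s).
Proof.
apply/nondecreasing_seqP => n; rewrite /S big_ord_recr /= lerDl.
by apply: mulr_ge0; [exact: ltW|rewrite indicE].
Qed.

Let S_ge0 N s : 0 <= S N s.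
Proof. 
by apply: sumr_ge0 => k _; apply: mulr_ge0; [exact: ltW|rewrite indicE].
Qed.

Let S_le2 N s : S N s <= 2.
Proof.
suff : S N s <= (3 - 3 * 3^-1 ^+ N) / 2 by have := w_gt0 N; lra.
elim: N => [|N IH]; first by rewrite /S big_ord0 expr0; lra.
rewrite /S big_ord_recr /= -/(S N s) exprS indicE.
have := w_gt0 N; move: IH; case: (s \in U N) => /=; lra.
Qed.

Definition ternary_code (s : T) : R := limn (S ^~ s).

Let S_cvg s : S ^~ s @ \oo --> ternary_code s.
Proof.
apply: nondecreasing_is_cvgn; first exact: S_nondecr.
by exists 2 => _ [n _ <-]; exact: S_le2.
Qed.

Lemma bmf_ternary_code : bmf ternary_code.
Proof.
split.
  apply: (@measurable_fun_cvg _ _ _ setT S) => // n.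
  have : bmf (S n); last by case.
  elim: n => [|n IH].
    have -> : S 0 = (fun=> 0) by apply/funext => s; rewrite /S big_ord0.
    exact: bmf_cst.
  have -> : S n.+1 = (fun s => S n s + 3^-1 ^+ n * \1_(U n) s).
    by apply/funext => s; rewrite /S big_ord_recr.
  apply: bmfD => //; apply: bmfM; [exact: bmf_cst|exact: bmf_indic].
exists 2 => s; rewrite ger0_norm.
  by apply: (cvgr_to_le (@S_cvg s)); apply: nearW => n; exact: S_le2.
by apply: (cvgr_to_ge (@S_cvg s)); apply: nearW => n; exact: S_ge0.
Qed.

(** Base 3 rather than 2: the later digits 0 and 1 cannot make up for the first
    digit that differs. *)
Lemma ternary_code_lt n s s' : (forall k, (k < n)%N -> U k s <-> U k s') ->
  U n s -> ~ U n s' -> ternary_code s' < ternary_code s.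
Proof.
move=> agree Us Us'.
have eqS N : (N <= n)%N -> S N s = S N s'.
  elim: N => [|N IH] Nn; first by rewrite /S !big_ord0.
  rewrite /S !big_ord_recr /= -/(S N s) -/(S N s') IH; last exact: ltnW.
  congr (_ + _ * _); rewrite !indicE; congr (nat_of_bool _)%:R.
  by apply/idP/idP; rewrite !inE => /(agree _ Nn).
have gap N : (3^-1 ^+ n + 3 * 3^-1 ^+ (n.+1 + N)) / 2 <=
    S (n.+1 + N)%N s - S (n.+1 + N)%N s'.
  elim: N => [|N IH].
    rewrite addn0 /S !big_ord_recr /= -/(S n s) -/(S n s') eqS// !indicE.
    by rewrite mem_set// memNset//= exprS; have := w_gt0 n; lra.
  rewrite addnS; move: (n.+1 + N)%N IH => m IH.
  rewrite /S !big_ord_recr /= -/(S m s) -/(S m s') exprS !indicE.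
  move: IH; have := w_gt0 m.
  by case: (s \in _); case: (s' \in _) => /=; lra.
have : 3^-1 ^+ n / 2 <= ternary_code s - ternary_code s'.
  have cvS : S N s - S N s' @[N --> \oo] --> ternary_code s - ternary_code s'.
    exact: cvgB (@S_cvg s) (@S_cvg s').
  apply: (cvgr_to_ge cvS).
  exists n.+1 => // N /= nN; rewrite -(subnKC nN).
  by have := gap (N - n.+1)%N; have := w_gt0 (n.+1 + (N - n.+1)); lra.
by have := w_gt0 n; lra.
Qed.

Lemma ternary_code_inj :
    (forall s s', s <> s' -> exists n, U n s /\ ~ U n s') ->
  injective ternary_code.
Proof.
move=> sep s s' ss'; apply: contrapT => /sep[n0 [Un0 nUn0]].
have ex : exists n, ~~ `[< U n s <-> U n s' >].
  by exists n0; apply/asboolPn => -[/(_ Un0)].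
have [n /asboolPn Un n_min] := ex_minnP ex.
have agree k : (k < n)%N -> U k s <-> U k s'.
  by move=> kn; apply: contrapT => /asboolPn /n_min; rewrite leqNgt kn.
have [Us|Us] := pselect (U n s); have [Us'|Us'] := pselect (U n s').
- by apply: Un.
- by have := ternary_code_lt agree Us Us'; rewrite ss' ltxx.
- have agree' k : (k < n)%N -> U k s' <-> U k s by move=> /agree; tauto.
  by have := ternary_code_lt agree' Us' Us; rewrite ss' ltxx.
- by apply: Un; tauto.
Qed.

End DiffuseFunction.

(** The fibres of an injective function have at most one point, so a fibre of
    positive measure would be an atom. *)
Lemma atomless_fibres (R : realType) d (T : measurableType d)
    (mu : {finite_measure set T -> \bar R}) (x : T -> R) :
  atomless mu -> measurable_fun setT x -> injective x ->
  forall a, {ae mu, forall s, x s <> a}.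
Proof.
move=> mu_atomless mx x_inj a; exists (x @^-1` [set a]).
have mA : measurable (x @^-1` [set a]).
  by rewrite -[X in measurable X]setTI; apply: mx => //; exact: measurable_set1.
split => //; last by move=> s /contrapT.
apply: contrapT => /eqP muA.
apply: (mu_atomless (x @^-1` [set a])); split => //.
  by rewrite lt0e muA measure_ge0.
move=> B mB BA; have [->|/set0P[s Bs]] := eqVneq B set0.
  by left; rewrite measure0.
right; congr (mu _); apply/seteqP; split => // s' s'a.
by have -> : s' = s by apply: x_inj; rewrite s'a (BA _ Bs).
Qed.

Lemma standard_diffuse (R : realType) d (T : measurableType d)
    (mu : {finite_measure set T -> \bar R}) :
  standard_measure_space mu ->
  exists x : T -> R, bmf x /\ forall a, {ae mu, forall s, x s <> a}.
Proof.
move=> [/standard_borel_separating[U [mU sep]] mu_atomless].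
exists (ternary_code R U); have bx := bmf_ternary_code R mU.
split => //; apply: atomless_fibres => //; first by case: bx.
exact: ternary_code_inj.
Qed.

(** * From real-valued integrals to measures of sections *)

Section Translation.
Context (R : realType) (dS dT : measure_display).
Context (S : measurableType dS) (T : measurableType dT).
Variable nu : {finite_measure set S -> \bar R}.
Variable eta : {finite_measure set T -> \bar R}.

Lemma integral_set_indic (b : T -> R) (A : set T) : bmf b -> measurable A ->
  (\int[eta]_(t in A) (b t)%:E)%E = (\int[eta]_t (\1_A t * b t))%:E.
Proof.
move=> bb mA; rewrite EFin_Rintegral; last first.
  by apply: bmfM => //; exact: bmf_indic.
rewrite integral_mkcond; apply: eq_integral => t _.
by rewrite patchE indicE; case: (t \in A); rewrite ?mul1r ?mul0r.
Qed.

Lemma measure_xsection_marg1 (F : set (S * T)) s : measurable F ->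
  eta (xsection F s) = (marg1 eta \1_F s)%:E.
Proof.
move=> mF; have mFs := measurable_xsection s mF.
rewrite -[LHS]fineK ?fin_num_measure// -int_indic//; congr EFin.
by apply: eq_Rintegral => t _; rewrite !indicE mem_xsection.
Qed.

Lemma measure_ysection_marg2 (F : set (S * T)) t : measurable F ->
  nu (ysection F t) = (marg2 nu \1_F t)%:E.
Proof.
move=> mF; have mFt := measurable_ysection t mF.
rewrite -[LHS]fineK ?fin_num_measure// -int_indic//; congr EFin.
by apply: eq_Rintegral => s _; rewrite !indicE mem_ysection.
Qed.

Lemma degreeE (E : set (S * T)) (A : set T) s : measurable E -> measurable A ->
  degree eta E A s = (\int[eta]_t (\1_A t * \1_E (s, t)))%:E.
Proof.
move=> mE mA; have mEs := measurable_xsection s mE.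
rewrite /degree -[LHS]fineK ?fin_num_measure//; last exact: measurableI.
rewrite -int_indic; last exact: measurableI.
congr EFin; apply: eq_Rintegral => t _; rewrite setIC indicI /= !indicE.
by rewrite mem_xsection.
Qed.

Lemma integral_min_degree (c : S -> R) (E : set (S * T)) (A : set T) :
  bmf c -> measurable E -> measurable A ->
  (\int[nu]_s Order.min (c s)%:E (degree eta E A s))%E =
  (\int[nu]_s Num.min (c s) (\int[eta]_t (\1_A t * \1_E (s, t))))%:E.
Proof.
move=> bc mE mA; have bE := bmf_indic R mE; have bA := bmf_indic R mA.
rewrite EFin_Rintegral; last first.
  apply: bmf_min => //.
  apply: (bmf_int2 eta (f := fun z => \1_A z.2 * \1_E z)); solve_bmf.
by apply: eq_integral => s _; rewrite degreeE// EFin_min.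
Qed.

(** Both conditions compare the two orders of integration of the indicator of
    [F], the first one over the whole product and the second one over [S * A].
    *)
Lemma section_necessary (b : T -> R) (c : S -> R) (E F : set (S * T)) :
    bmf b -> bmf c -> measurable E -> measurable F -> F `<=` E ->
    {ae nu, forall s, marg1 eta \1_F s = c s} ->
    {ae eta, forall t, marg2 nu \1_F t = b t} ->
  \int[eta]_t b t = \int[nu]_s c s /\
  forall A : set T, measurable A -> \int[eta]_t (\1_A t * b t) <=
    \int[nu]_s Num.min (c s) (\int[eta]_t (\1_A t * \1_E (s, t))).
Proof.
move=> bb bc mE mF FE Fc Fb.
have bE := bmf_indic R mE; have bF := bmf_indic R mF.
have bF1 : bmf (marg1 eta (\1_F : _ -> R)) by exact: bmf_marg1.
have bF2 : bmf (marg2 nu (\1_F : _ -> R)) by exact: bmf_marg2.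
split=> [|A mA].
  rewrite -(ae_eq_int bF2 bb Fb) -(ae_eq_int bF1 bc Fc).
  by rewrite -[RHS](int_prod12 nu eta bF) int_prod21.
have bA := bmf_indic R mA.
have bAF : bmf (fun z : S * T => \1_A z.2 * \1_F z : R) by solve_bmf.
have bAE : bmf (fun z : S * T => \1_A z.2 * \1_E z : R) by solve_bmf.
have bAE1 := bmf_int2 eta bAE; rewrite /= in bAE1.
have -> : \int[eta]_t (\1_A t * b t) =
    \int[nu]_s \int[eta]_t (\1_A t * \1_F (s, t)).
  transitivity (\int[eta]_t (\1_A t * marg2 nu \1_F t)).
    apply/esym/ae_eq_int; [exact: bmfM|exact: bmfM|].
    by apply: filterS Fb => t ->.
  by rewrite (int_marg2 nu eta bF bA) int_prod12.
have -> : \int[nu]_s Num.min (c s) (\int[eta]_t (\1_A t * \1_E (s, t))) =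
    \int[nu]_s Num.min (marg1 eta \1_F s) (\int[eta]_t (\1_A t * \1_E (s, t))).
  apply/esym/ae_eq_int; [exact: bmf_min|exact: bmf_min|].
  by apply: filterS Fc => s ->.
apply: bmf_le_int => [||s]; [exact: bmf_int2 bAF|exact: bmf_min|].
have bAFs : bmf (fun t => \1_A t * \1_F (s, t) : R) := bmf_pair1 s bAF.
have bAEs : bmf (fun t => \1_A t * \1_E (s, t) : R) := bmf_pair1 s bAE.
rewrite le_min; apply/andP; split.
  apply: bmf_le_int => //; first exact: bmf_pair1.
  move=> t; rewrite !indicE.
  by case: (_ \in A); case: (_ \in F); rewrite ?mul1r ?mul0r.
apply: bmf_le_int => // t; apply: ler_wpM2l; first by rewrite indicE.
rewrite !indicE ler_nat.
by have [/set_mem/FE/mem_set ->|] := boolP ((s, t) \in F).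
Qed.

(** An extremal solution below an indicator function is itself almost everywhere
    an indicator function. *)
Lemma section_sufficient (b : T -> R) (c : S -> R) (E : set (S * T))
    (f : S * T -> R) :
    measurable E -> solutions nu eta \1_E c b f ->
    {ae prod_measure nu eta, forall z, f z * (\1_E z - f z) = 0} ->
  exists F : set (S * T), [/\ measurable F, F `<=` E,
    {ae eta, forall t, nu (ysection F t) = (b t)%:E} &
    {ae nu, forall s, eta (xsection F s) = (c s)%:E}].
Proof.
move=> mE [Kf fc fb] f01; pose F := [set z | f z = 1].
have bf := between0_bmf (bmf_indic R mE) Kf.
have mF : measurable F.
  rewrite -[X in measurable X]setTI.
  exact: (Kf.1 measurableT [set 1] (measurable_set1 1)).
have bF := bmf_indic R mF.
have fF : {ae prod_measure nu eta, forall z, f z = \1_F z}.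
  apply: filterS f01 => z /eqP; rewrite mulf_eq0 subr_eq0.
  have [Fz|nFz] := pselect (F z).
    by rewrite [\1_F z]indicE mem_set.
  rewrite [\1_F z]indicE memNset//= => /orP[/eqP//|/eqP].
  by rewrite indicE; case: (z \in E) => //= /esym.
have [fF1 fF2] := ae_prod fF.
exists F; split=> //.
- move=> z Fz; have /andP[_] := Kf.2 z; rewrite Fz indicE.
  by have [/set_mem//|_] := boolP (z \in E); rewrite ler10.
- apply: filterS2 fb fF2 => t <- fFt; rewrite measure_ysection_marg2//.
  congr EFin; apply: ae_eq_int; [exact: bmf_pair2|exact: bmf_pair2|].
  by apply: filterS fFt => s ->.
- apply: filterS2 fc fF1 => s <- fFs; rewrite measure_xsection_marg1//.
  congr EFin; apply: ae_eq_int; [exact: bmf_pair1|exact: bmf_pair1|].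
  by apply: filterS fFs => t ->.
Qed.

End Translation.

Theorem corollary7p12 (R : realType) (dS dT : measure_display)
    (S : measurableType dS) (T : measurableType dT)
    (nu : {finite_measure set S -> \bar R})
    (eta : {finite_measure set T -> \bar R})
    (hS : standard_measure_space nu) (hT : standard_measure_space eta)
    (b : T -> R) (c : S -> R)
    (mb : measurable_fun setT b) (mc : measurable_fun setT c)
    (hb : forall t, (0 <= (b t)%:E <= nu setT)%E)
    (hc : forall s, (0 <= (c s)%:E <= eta setT)%E)
    (E : set (S * T)) (mE : measurable E) :
  (exists F : set (S * T),
     [/\ measurable F, F `<=` E,
         {ae eta, forall t, nu (ysection F t) = (b t)%:E} &
         {ae nu, forall s, eta (xsection F s) = (c s)%:E}])
  <->
  ((\int[eta]_t (b t)%:E = \int[nu]_s (c s)%:E)%E /\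
   forall A : set T, measurable A ->
     (\int[eta]_(t in A) (b t)%:E
        <= \int[nu]_s Order.min (c s)%:E (degree eta E A s))%E).
Proof.
have bb : bmf b by apply: bmf_of_bounds mb hb; exact: fin_num_measure.
have bc : bmf c by apply: bmf_of_bounds mc hc; exact: fin_num_measure.
rewrite -!EFin_Rintegral//; split=> [[F [mF FE Fb Fc]]|[int_eqE cut]].
  have F1 : {ae nu, forall s, marg1 eta \1_F s = c s}.
    by apply: filterS Fc => s; rewrite measure_xsection_marg1// => -[].
  have F2 : {ae eta, forall t, marg2 nu \1_F t = b t}.
    by apply: filterS Fb => t; rewrite measure_ysection_marg2// => -[].
  have [int_eq cut] := section_necessary bb bc mE mF FE F1 F2.
  split=> [|A mA]; first by rewrite int_eq.
  by rewrite integral_set_indic// integral_min_degree// lee_fin cut.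
have int_eq := EFin_inj int_eqE.
have [x [bx x_diffuse]] := standard_diffuse hS.
have [y [b_y y_diffuse]] := standard_diffuse hT.
have bE := bmf_indic R mE.
have E_ge0 z : 0 <= \1_E z :> R by rewrite indicE.
have [|f0 [Kf0 f0c f0b]] := fractional_solution bE bc bb E_ge0 int_eq.
  move=> A mA; have := cut A mA.
  by rewrite integral_set_indic// integral_min_degree// lee_fin.
have [f Sf f01] := extremal_solution bE bx b_y x_diffuse y_diffuse
  (ex_intro _ f0 (And3 Kf0 f0c f0b)).
exact: section_sufficient mE Sf f01.
Qed.
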